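(* Let $\pi_{\mathcal{GH}}:\mathcal{GH}\to\mu(\mathcal{GH})$ be the good moduli space of the stack $\mathcal{GH}$ of compact metric spaces. Then: (i) The points of $\mu(\mathcal{GH})$ correspond bijectively to isometry classes of non-empty compact metric spaces, via $C\mapsto[C]:=\pi_{\mathcal{GH}}(C)$, where $C$ is regarded as the object $C\to *$ of $\mathcal{GH}( * )$. (ii) For any non-empty compact metric spaces $C$ and $D$, the distance $d_{\mu(\mathcal{GH})}([C],[D])$ equals the Gromov--Hausdorff distance between $C$ and $D$. In particular, $\mu(\mathcal{GH})$ is isometric to the Gromov--Hausdorff space (the set of isometry classes of non-empty compact metric spaces with the Gromov--Hausdorff distance).
   Context: An extended pseudometric space is a set $X$ with a symmetric function $d_X:X\times X\to[0,\infty]$ vanishing on the diagonal and satisfying the triangle inequality; $\mathrm{epMet}$ is the category of these with 1-Lipschitz maps. $\mathrm{Met}$ is the full subcategory of metric spaces (finite distances, $d(x,y)=0\Rightarrow x=y$), and $\mathrm{tbMet}\subset\mathrm{Met}$ that of totally bounded metric spaces. Fiber products carry the maximum of the two distances. $B_X(x,r)$ is the open ball. $d^H_X$ is the Hausdorff distance on subsets of $X$. A 1-Lipschitz map $f:X\to B$ of metric spaces is a submetry if it is surjective and $d^H_X(f^{-1}(b_0),f^{-1}(b_1))\le d_B(b_0,b_1)$ for all $b_0,b_1\in B$. It is proper if it is a closed map with compact fibers. A 1-Lipschitz map $f:X\to Y$ of metric spaces is a local submetry if for every $x\in X$ there is $r>0$ such that for every $x'\in B_X(x,r)$ and $0<s<r-d_X(x,x')$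 one has $f(B_X(x',s))=B_Y(f(x'),s)$. A family $\{f_i:U_i\to X\}_{i\in I}$ in $\mathrm{tbMet}$ is an lsm covering if each $f_i$ is a local submetry and for all $x_1,x_2,x_3\in X$ and $\varepsilon>0$ there are $i\in I$ and $u_k\in f_i^{-1}(x_k)$ ($k=1,2,3$) with $d_{U_i}(u_1,u_2)<d_X(x_1,x_2)+\varepsilon$ and $d_{U_i}(u_2,u_3)<d_X(x_2,x_3)+\varepsilon$. These coverings form a Grothendieck pretopology; $\mathrm{tbMet}_{\mathrm{lsm}}$ is the resulting site. $\mathcal{GH}$ is the stack in groupoids over $\mathrm{tbMet}_{\mathrm{lsm}}$ whose objects over $T\in\mathrm{tbMet}$ are the proper submetries $P\to T$ with $P\in\mathrm{Met}$; morphisms are commutative squares in $\mathrm{Met}$ inducing an isomorphism $P_1\cong P_2\times_{T_2}T_1$. $*$ denotes the one-point metric space. Good moduli space. The functor $\mathrm{epMet}\to\mathrm{PSh}(\mathrm{tbMet})$, $X\mapsto\mathrm{Hom}_{\mathrm{epMet}}(-,X)|_{\mathrm{tbMet}}$, is fully faithful with values in lsm sheaves, and has a left adjoint $\mu:\mathrm{PSh}(\mathrm{tbMet})\to\mathrm{epMet}$ (the left Kan extension of the inclusion $\mathrm{tbMet}\subset\mathrm{epMet}$ along the Yoneda embedding). For a stack in groupoids $\mathcal X$ over $\mathrm{tbMet}_{\mathrm{lsm}}$, $\pi_0(\mathcal X)$ is the sheafification of $T\mapsto\{\text{isomorphism classes of }\mathcal X(T)\}$; put $\mu(\mathcal X):=\mu(\pi_0(\mathcal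 X))$. The natural morphism of stacks $\pi_{\mathcal X}:\mathcal X\to\mu(\mathcal X)$ is the good moduli space of $\mathcal X$; it is the universal morphism from $\mathcal X$ to an extended pseudometric space. On $*$-points it gives a map from objects of $\mathcal X( * )$ to points of $\mu(\mathcal X)$. *)

(* Defs.v *)
From HB Require Import structures.
From mathcomp Require Import all_boot all_order all_algebra.
From mathcomp Require Import all_classical all_reals.
From mathcomp Require Import ereal topology.

Set Implicit Arguments.
Unset Strict Implicit.
Unset Printing Implicit Defensive.

Import Order.TTheory GRing.Theory Num.Theory.
Local Open Scope classical_set_scope.
Local Open Scope ring_scope.

(* Metric spaces are the library's [metricType R]; they may be empty, and the
   underlying [choiceType] structure is no restriction, since classically every
   type carries one ([gen_choiceMixin]). *)
Section Metric.
Context {R : realType}.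

Record lipMap (X Y : metricType R) := LipMap {
  lip_fun :> X -> Y;
  lipP : forall x y, mdist (lip_fun x) (lip_fun y) <= mdist x y }.

Lemma lip_eq (X Y : metricType R) (f g : lipMap X Y) :
  (forall x, f x = g x) -> f = g.
Proof.
case: f g => f fP [g gP] /= /funext fg; subst g; congr LipMap.
exact: Prop_irrelevance.
Qed.

Definition lip_id (X : metricType R) : lipMap X X :=
  @LipMap X X id (fun x y => lexx _).

Definition lip_comp (X Y Z : metricType R) (g : lipMap Y Z) (f : lipMap X Y) :
  lipMap X Z :=
  @LipMap X Z (g \o f) (fun x y => le_trans (lipP g _ _) (lipP f _ _)).

Definition lip_iso (X Y : metricType R) (f : lipMap X Y) :=
  exists g : lipMap Y X, cancel f g /\ cancel g f.

Definition totally_bounded (X : metricType R) :=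
  forall e : R, 0 < e ->
    exists s : seq X, forall x, exists2 y, y \in s & mdist y x < e.

Record tbMet := TbMet {
  tb_sp :> metricType R;
  tbP : totally_bounded tb_sp }.

(* Infimum of the [r] such that each set lies in the open [r]-neighbourhood of
   the other; the infimum of no real is [+oo]. *)
Definition hausdorff_dist (X : metricType R) (A B : set X) : \bar R :=
  ereal_inf [set r%:E | r in [set r : R | [/\ 0 < r,
    forall a, A a -> exists2 b, B b & mdist a b < r &
    forall b, B b -> exists2 a, A a & mdist a b < r]]].

Definition submetry (X B : metricType R) (f : lipMap X B) :=
  (forall b, exists x, f x = b) /\
  forall b0 b1, (hausdorff_dist (f @^-1` [set b0]) (f @^-1` [set b1])
                 <= (mdist b0 b1)%:E)%E.

Definition proper_map (X B : metricType R) (f : lipMap X B) :=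
  (forall A : set X, closed A -> closed (f @` A)) /\
  forall b, compact (f @^-1` [set b]).

Definition local_submetry (X Y : metricType R) (f : lipMap X Y) :=
  forall x, exists2 r : R, 0 < r & forall x', ball x r x' ->
    forall s, 0 < s < r - mdist x x' -> f @` ball x' s = ball (f x') s.

Record lsm_covering (X : tbMet) (I : Type) (U : I -> tbMet)
    (f : forall i, lipMap (U i) X) : Prop := LsmCovering {
  lsm_local : forall i, local_submetry (f i);
  lsm_points : forall (x1 x2 x3 : X) (e : R), 0 < e ->
    exists i (u1 u2 u3 : U i),
      [/\ f i u1 = x1, f i u2 = x2, f i u3 = x3,
          mdist u1 u2 < mdist x1 x2 + e & mdist u2 u3 < mdist x2 x3 + e] }.

(* Fiber product, with the maximum of the two distances (see [fprod_distE]). *)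
Record fprod (X Y Z : metricType R) (f : lipMap X Z) (g : lipMap Y Z) := FProd {
  fp1 : X;
  fp2 : Y;
  fpE : f fp1 = g fp2 }.

End Metric.
Arguments tbMet : clear implicits.

Section FiberProduct.
Context {R : realType} (X Y Z : metricType R).
Context (f : lipMap X Z) (g : lipMap Y Z).

Lemma fprod_eq (p q : fprod f g) : fp1 p = fp1 q -> fp2 p = fp2 q -> p = q.
Proof.
case: p q => [x y e] [x' y' e'] /= xx' yy'; subst x' y'; congr FProd.
exact: Prop_irrelevance.
Qed.

HB.instance Definition _ := gen_eqMixin (fprod f g).
HB.instance Definition _ := gen_choiceMixin (fprod f g).

Let dist (p q : fprod f g) : R :=
  Num.max (mdist (fp1 p) (fp1 q)) (mdist (fp2 p) (fp2 q)).

Let distxx p : dist p p = 0.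
Proof. by rewrite /dist !mdistxx maxxx. Qed.

Let dist_pos p q : dist p q = 0 -> p = q.
Proof.
move=> d0; apply: fprod_eq; apply: (@mdist_positivity R); apply/eqP;
  by rewrite eq_le mdist_ge0 andbT -d0 /dist le_max lexx ?orbT.
Qed.

Let dist_sym p q : dist p q = dist q p.
Proof. by rewrite /dist metric_sym [X in Num.max _ X]metric_sym. Qed.

Let dist_tri q p r : dist p r <= dist p q + dist q r.
Proof.
rewrite /dist ge_max; apply/andP; split.
  by apply: (le_trans (metric_triangle _ (fp1 q) _)); apply: lerD;
    rewrite le_max; apply/orP; left.
by apply: (le_trans (metric_triangle _ (fp2 q) _)); apply: lerD;
  rewrite le_max; apply/orP; right.
Qed.

HB.instance Definition _ :=
  @isMetric.Build R (fprod f g) dist distxx dist_pos dist_sym dist_tri.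

Lemma fprod_distE (p q : fprod f g) :
  mdist p q = Num.max (mdist (fp1 p) (fp1 q)) (mdist (fp2 p) (fp2 q)).
Proof. by []. Qed.

Lemma fp1_lip (p q : fprod f g) : mdist (fp1 p) (fp1 q) <= mdist p q.
Proof. by rewrite fprod_distE le_max; apply/orP; left. Qed.

Lemma fp2_lip (p q : fprod f g) : mdist (fp2 p) (fp2 q) <= mdist p q.
Proof. by rewrite fprod_distE le_max; apply/orP; right. Qed.

Definition fpr1 : lipMap (fprod f g) X := LipMap fp1_lip.
Definition fpr2 : lipMap (fprod f g) Y := LipMap fp2_lip.

Lemma fprodE : lip_comp f fpr1 = lip_comp g fpr2.
Proof. by apply: lip_eq => p; exact: fpE. Qed.

Lemma fpair_lip (W : metricType R) (a : lipMap W X) (b : lipMap W Y)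
    (ab : forall w, f (a w) = g (b w)) (v w : W) :
  mdist (FProd (ab v)) (FProd (ab w)) <= mdist v w.
Proof. by rewrite fprod_distE ge_max !lipP. Qed.

Definition fpair (W : metricType R) (a : lipMap W X) (b : lipMap W Y)
    (ab : forall w, f (a w) = g (b w)) : lipMap W (fprod f g) :=
  LipMap (fpair_lip ab).

End FiberProduct.

Definition point_space (R : realType) : Type := unit.

Section Point.
Context {R : realType}.
HB.instance Definition _ := Choice.on (point_space R).

Let dist (p q : point_space R) : R := 0.

Let distxx p : dist p p = 0. Proof. by []. Qed.
Let dist_pos p q : dist p q = 0 -> p = q.
Proof. by case: p; case: q. Qed.
Let dist_sym p q : dist p q = dist q p. Proof. by []. Qed.
Let dist_tri q p r : dist p r <= dist p q + dist q r.
Proof. by rewrite /dist addr0. Qed.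

HB.instance Definition _ :=
  @isMetric.Build R (point_space R) dist distxx dist_pos dist_sym dist_tri.

Lemma point_distE (p q : point_space R) : mdist p q = 0 :> R.
Proof. by []. Qed.

Lemma point_tb : totally_bounded (point_space R : metricType R).
Proof.
by move=> e e0; exists [:: tt] => -[]; exists tt; rewrite ?inE// point_distE.
Qed.

Definition point_tbMet : tbMet R := TbMet point_tb.

Lemma const_lip (X Y : metricType R) (y : Y) (p q : X) :
  mdist ((fun=> y) p) ((fun=> y) q) <= mdist p q.
Proof. by rewrite mdistxx mdist_ge0. Qed.

Definition lip_const (X Y : metricType R) (y : Y) : lipMap X Y :=
  LipMap (@const_lip X Y y).
End Point.
Arguments point_tbMet : clear implicits.

Section Covering.
Context {R : realType}.
Implicit Types X Y Z S T U V W : tbMet R.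

Lemma in_ball (X : metricType R) (x y : X) (r : R) :
  ball x r y <-> mdist x y < r.
Proof. by rewrite ballEmdist. Qed.

Lemma fprod_tb X Y Z (f : lipMap X Z) (g : lipMap Y Z) :
  totally_bounded (fprod f g : metricType R).
Proof.
move=> e e0; have e20 : 0 < e / 2 by rewrite divr_gt0.
have [sx sxP] := tbP X e20; have [sy syP] := tbP Y e20.
have /choice[c cP] : forall xy : X * Y, exists c : option (fprod f g),
    forall p : fprod f g, mdist xy.1 (fp1 p) < e / 2 ->
    mdist xy.2 (fp2 p) < e / 2 -> exists2 q, c = Some q &
      mdist xy.1 (fp1 q) < e / 2 /\ mdist xy.2 (fp2 q) < e / 2.
  move=> xy; have [[q [q1 q2]]|nq] := pselect (exists q : fprod f g,
    mdist xy.1 (fp1 q) < e / 2 /\ mdist xy.2 (fp2 q) < e / 2).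
    by exists (Some q) => p _ _; exists q.
  by exists None => p p1 p2; exfalso; apply: nq; exists p.
exists (pmap c [seq (x, y) | x <- sx, y <- sy]) => p.
have [x xs xp] := sxP (fp1 p); have [y ys yp] := syP (fp2 p).
have [q cq [q1 q2]] := cP (x, y) p xp yp.
exists q.
  rewrite mem_pmap -cq; apply: map_f.
  by apply/allpairsP; exists (x, y).
rewrite fprod_distE gt_max [e]splitr; apply/andP; split;
  apply: (le_lt_trans (metric_triangle _ _ _)).
- by apply: ltrD xp; rewrite metric_sym.
- by apply: ltrD yp; rewrite metric_sym.
Qed.

Definition tb_fprod X Y Z (f : lipMap X Z) (g : lipMap Y Z) : tbMet R :=
  TbMet (fprod_tb f g).

Definition tb_fpr1 X Y Z (f : lipMap X Z) (g : lipMap Y Z) :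
  lipMap (tb_fprod f g) X := fpr1 f g.

Definition tb_fpr2 X Y Z (f : lipMap X Z) (g : lipMap Y Z) :
  lipMap (tb_fprod f g) Y := fpr2 f g.

Definition tb_fpair X Y Z (f : lipMap X Z) (g : lipMap Y Z) W
    (a : lipMap W X) (b : lipMap W Y) (ab : forall w, f (a w) = g (b w)) :
  lipMap W (tb_fprod f g) := fpair ab.

Lemma local_submetry_id X : local_submetry (lip_id X).
Proof. by move=> x; exists 1 => // x' _ s _; exact: image_id. Qed.

Lemma local_submetry_comp X Y Z (f : lipMap X Y) (g : lipMap Y Z) :
  local_submetry f -> local_submetry g -> local_submetry (lip_comp g f).
Proof.
move=> lf lg x; have [r r0 rP] := lf x; have [t t0 tP] := lg (f x).
exists (Num.min r t) => [|x']; first by rewrite lt_min r0 t0.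
rewrite ballEmdist /= lt_min => /andP[xr xt] s /andP[s0].
rewrite ltrBrDr lt_min -!ltrBrDr => /andP[sr st].
rewrite (_ : _ @` _ = g @` (f @` ball x' s)); last by rewrite image_comp.
rewrite rP ?tP ?ballEmdist //= ?s0 //=.
  exact: le_lt_trans (lipP f _ _) xt.
by apply: (lt_le_trans st); rewrite lerD2l lerN2 lipP.
Qed.

Lemma local_submetry_pullback X Y Z (f : lipMap X Z) (g : lipMap Y Z) :
  local_submetry f -> local_submetry (tb_fpr2 f g).
Proof.
move=> lf p; have [r r0 rP] := lf (fp1 p).
exists r => // p' /in_ball pp' s /andP[s0 sr].
have p1 : mdist (fp1 p) (fp1 p') <= mdist p p' := fp1_lip p p'.
apply/seteqP; split => [_ [q /in_ball p'q <-]|y /in_ball yp'].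
  by apply/in_ball; apply: le_lt_trans p'q; exact: fp2_lip.
have : ball (f (fp1 p')) s (g y).
  by apply/in_ball; rewrite fpE; apply: le_lt_trans yp'; exact: lipP.
have p'r : ball (fp1 p) r (fp1 p') by apply/in_ball; exact: le_lt_trans pp'.
have sr' : 0 < s < r - mdist (fp1 p) (fp1 p').
  by rewrite s0 /=; apply: (lt_le_trans sr); rewrite lerD2l lerN2.
rewrite -(rP _ p'r _ sr') => -[x /in_ball xp' xy].
by exists (FProd xy) => //; apply/in_ball; rewrite fprod_distE gt_max xp'.
Qed.

Lemma lsm_covering_id X : @lsm_covering R X unit (fun=> X) (fun=> lip_id X).
Proof.
split=> [_|x1 x2 x3 e e0]; first exact: local_submetry_id.
by exists tt, x1, x2, x3; rewrite !ltrDl.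
Qed.

Lemma lsm_covering_pullback X (I : Type) (U : I -> tbMet R)
    (f : forall i, lipMap (U i) X) Y (g : lipMap Y X) :
  lsm_covering f -> lsm_covering (fun i => tb_fpr2 (f i) g).
Proof.
move=> [lf pf]; split=> [i|y1 y2 y3 e e0].
  exact: local_submetry_pullback.
have [i [u1 [u2 [u3 [e1 e2 e3 d1 d2]]]]] := pf (g y1) (g y2) (g y3) e e0.
exists i, (FProd e1), (FProd e2), (FProd e3); split=> //;
  rewrite fprod_distE gt_max ltrDl e0 andbT.
  by apply: (lt_le_trans d1); rewrite lerD2r lipP.
by apply: (lt_le_trans d2); rewrite lerD2r lipP.
Qed.

Lemma lsm_covering_comp X (I : Type) (U : I -> tbMet R)
    (f : forall i, lipMap (U i) X) (J : I -> Type)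
    (V : forall i, J i -> tbMet R) (g : forall i j, lipMap (V i j) (U i)) :
  lsm_covering f -> (forall i, lsm_covering (g i)) ->
  @lsm_covering R X {i : I & J i} (fun k => V (tag k) (tagged k))
    (fun k => lip_comp (f (tag k)) (g (tag k) (tagged k))).
Proof.
move=> [lf pf] cg; split=> [k|x1 x2 x3 e e0].
  by apply: local_submetry_comp => //; case: (cg (tag k)).
have e20 : 0 < e / 2 by rewrite divr_gt0.
have [i [u1 [u2 [u3 [<- <- <- d1 d2]]]]] := pf x1 x2 x3 _ e20.
have [_ /(_ u1 u2 u3 _ e20)] := cg i.
move=> [j [v1 [v2 [v3 [e1 e2 e3 b1 b2]]]]].
exists (Tagged J j), v1, v2, v3; split=> /=.
- by rewrite e1.
- by rewrite e2.
- by rewrite e3.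
- by apply: (lt_trans b1); rewrite [in ltRHS](splitr e) addrA ltrD2r.
- by apply: (lt_trans b2); rewrite [in ltRHS](splitr e) addrA ltrD2r.
Qed.

End Covering.

Section ExtendedPseudometric.
Context {R : realType}.
Local Open Scope ereal_scope.

Definition is_epdist (X : Type) (d : X -> X -> \bar R) :=
  [/\ forall x y, 0 <= d x y,
      forall x, d x x = 0,
      forall x y, d x y = d y x &
      forall x y z, d x z <= d x y + d y z].

Record epMet := EpMet {
  ep_car :> Type;
  edist : ep_car -> ep_car -> \bar R;
  edistP : is_epdist edist }.

Record epMap (X Y : epMet) := EpMap {
  ep_fun :> X -> Y;
  epP : forall x y, edist (ep_fun x) (ep_fun y) <= edist x y }.

Lemma epMap_eq (X Y : epMet) (f g : epMap X Y) : (forall x, f x = g x) -> f = g.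
Proof.
case: f g => f fP [g gP] /= /funext fg; subst g; congr EpMap.
exact: Prop_irrelevance.
Qed.

Definition ep_comp (X Y Z : epMet) (g : epMap Y Z) (f : epMap X Y) :
  epMap X Z :=
  @EpMap X Z (g \o f) (fun x y => le_trans (epP g _ _) (epP f _ _)).

Lemma met_epdist (X : metricType R) :
  is_epdist (fun x y : X => (mdist x y)%:E).
Proof.
split=> *; rewrite ?lee_fin ?mdist_ge0 ?mdistxx//.
  by rewrite metric_sym.
exact: metric_triangle.
Qed.

Definition ep_of_met (X : metricType R) : epMet := EpMet (met_epdist X).

Lemma ep_of_lip_subproof (X Y : metricType R) (f : lipMap X Y) (x y : X) :
  (mdist (f x) (f y))%:E <= (mdist x y)%:E.
Proof. by rewrite lee_fin lipP. Qed.

Definition ep_of_lip (X Y : metricType R) (f : lipMap X Y) :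
  epMap (ep_of_met X) (ep_of_met Y) :=
  @EpMap (ep_of_met X) (ep_of_met Y) f (ep_of_lip_subproof f).

End ExtendedPseudometric.
Arguments epMet : clear implicits.

Section Presheaf.
Context {R : realType}.
Implicit Types S T U V W X Y Z : tbMet R.

Record presheaf := Presheaf {
  psh :> tbMet R -> Type;
  res : forall S T, lipMap S T -> psh T -> psh S;
  res_id : forall T (a : psh T), res (lip_id T) a = a;
  res_comp : forall S T V (f : lipMap S T) (g : lipMap V S) (a : psh T),
    res (lip_comp f g) a = res g (res f a) }.

Record pshMap (F G : presheaf) := PshMap {
  psh_fun :> forall T, F T -> G T;
  psh_nat : forall S T (f : lipMap S T) (a : F T),
    psh_fun (res f a) = res f (psh_fun a) }.

Definition psh_comp (F G H : presheaf) (q : pshMap G H) (p : pshMap F G) :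
  pshMap F H.
Proof.
by exists (fun T a => q T (p T a)) => S T f a; rewrite !psh_nat.
Defined.

Definition is_sheaf (F : presheaf) :=
  forall T (I : Type) (U : I -> tbMet R) (f : forall i, lipMap (U i) T),
    lsm_covering f ->
    forall s : forall i, F (U i),
      (forall i j, res (tb_fpr1 (f i) (f j)) (s i) =
                   res (tb_fpr2 (f i) (f j)) (s j)) ->
      exists! t : F T, forall i, res (f i) t = s i.

Definition hom_psh (X : epMet R) : presheaf.
Proof.
exists (fun T => epMap (ep_of_met T) X)
  (fun S T f a => ep_comp a (ep_of_lip f)) => *; exact: epMap_eq.
Defined.

Lemma hom_psh_sheaf (Y : epMet R) : is_sheaf (hom_psh Y).
Proof.
move=> T I U f [lf pf] s sE.
have {}sE i j (u : U i) (v : U j) : f i u = f j v -> s i u = s j v.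
  move=> uv; have E := sE i j.
  exact: (congr1 (fun a : hom_psh Y (tb_fprod (f i) (f j)) =>
    ep_fun a (FProd uv)) E).
have /choice[a aP] (t : T) : exists y : Y, forall i u, f i u = t -> s i u = y.
  have [i [u [_ [_ [ut _ _ _ _]]]]] := pf t t t 1 ltr01.
  by exists (s i u) => j v vt; apply: sE; rewrite ut.
have aL (t t' : ep_of_met T) : (edist (a t) (a t') <= edist t t')%E.
  apply/lee_addgt0Pr => e e0.
  have [i [u [u' [_ [ut ut' _ d _]]]]] := pf t t' t' e e0.
  rewrite -(aP _ _ _ ut) -(aP _ _ _ ut').
  apply: le_trans (epP (s i) u u') _.
  by rewrite -EFinD lee_fin; exact: ltW.
exists (EpMap aL); split=> [i|b bE].
  by apply: epMap_eq => u /=; rewrite -(aP _ i u).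
apply: epMap_eq => t /=.
have [i [u [_ [_ [ut _ _ _ _]]]]] := pf t t t 1 ltr01.
by rewrite -(aP _ _ _ ut) -bE /= ut.
Qed.

End Presheaf.
Arguments presheaf : clear implicits.

Section Sheafification.
Context {R : realType} (F : presheaf R).
Implicit Types S T U V W X Y Z : tbMet R.

Definition loc_eq V (a b : F V) :=
  exists (I : Type) (W : I -> tbMet R) (f : forall i, lipMap (W i) V),
    lsm_covering f /\ forall i, res (f i) a = res (f i) b.

Lemma loc_eq_refl V (a : F V) : loc_eq a a.
Proof.
exists unit, (fun=> V), (fun=> lip_id V); split=> //.
exact: lsm_covering_id.
Qed.

Lemma loc_eq_sym V (a b : F V) : loc_eq a b -> loc_eq b a.
Proof. by move=> [I [W [f [cf ab]]]]; exists I, W, f; split=> // i; rewrite ab. Qed.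

Lemma fprod_res (P : presheaf R) X Y Z (f : lipMap X Z) (g : lipMap Y Z)
    (a : P Z) :
  res (tb_fpr2 f g) (res g a) = res (tb_fpr1 f g) (res f a).
Proof.
rewrite -!res_comp (_ : lip_comp g _ = lip_comp f (tb_fpr1 f g)) //.
by apply: lip_eq => p /=; rewrite -fpE.
Qed.

Lemma loc_eq_res V W (g : lipMap W V) (a b : F V) :
  loc_eq a b -> loc_eq (res g a) (res g b).
Proof.
move=> [I [U [f [cf ab]]]].
exists I, (fun i => tb_fprod (f i) g), (fun i => tb_fpr2 (f i) g); split.
  exact: lsm_covering_pullback.
by move=> i; rewrite !fprod_res ab.
Qed.

Lemma loc_eq_local V (I : Type) (W : I -> tbMet R)
    (f : forall i, lipMap (W i) V) (a b : F V) :
  lsm_covering f -> (forall i, loc_eq (res (f i) a) (res (f i) b)) ->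
  loc_eq a b.
Proof.
move=> cf lab.
pose J i := projT1 (cid (lab i)); have JP i := projT2 (cid (lab i)).
pose U i := projT1 (cid (JP i)); have UP i := projT2 (cid (JP i)).
pose g i := projT1 (cid (UP i)); have gP i := projT2 (cid (UP i)).
exists {i : I & J i}, (fun k => U (tag k) (tagged k)),
  (fun k => lip_comp (f (tag k)) (g (tag k) (tagged k))); split.
  by apply: lsm_covering_comp => // i; case: (gP i).
by move=> [i j] /=; rewrite !res_comp; case: (gP i) => _; exact.
Qed.

Lemma loc_eq_trans V (b a c : F V) : loc_eq a b -> loc_eq b c -> loc_eq a c.
Proof.
move=> [I [W [f [cf ab]]]] bc; apply: (loc_eq_local cf) => i.
by rewrite ab; exact: loc_eq_res.
Qed.

(* A section over [T] of the associated sheaf is encoded by its graph, i.e.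
   the set of triples [(V, g : V -> T, s \in F V)] such that [s] represents the
   pullback of that section along [g]. *)
Record shsec T := ShSec {
  rep : forall V, lipMap V T -> F V -> Prop;
  rep_res : forall V W (g : lipMap V T) (h : lipMap W V) (s : F V),
    rep g s -> rep (lip_comp g h) (res h s);
  rep_local : forall V (g : lipMap V T) (s : F V) (I : Type)
    (W : I -> tbMet R) (f : forall i, lipMap (W i) V), lsm_covering f ->
    (forall i, rep (lip_comp g (f i)) (res (f i) s)) -> rep g s;
  rep_loc_eq : forall V (g : lipMap V T) (s s' : F V),
    rep g s -> rep g s' -> loc_eq s s';
  rep_cover : exists (I : Type) (U : I -> tbMet R) (f : forall i, lipMap (U i) T)
    (s : forall i, F (U i)), lsm_covering f /\ forall i, rep (f i) (s i) }.

Lemma shsec_eq T (a b : shsec T) :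
  (forall V (g : lipMap V T) s, rep a g s <-> rep b g s) -> a = b.
Proof.
case: a b => [r a b c d] [r' a' b' c' d'] /= rr'.
have E : r = r'.
  do 3 (apply: functional_extensionality_dep => ?); exact/propext/rr'.
subst r'; congr ShSec; exact: Prop_irrelevance.
Qed.

Lemma lip_compA X Y Z W (h : lipMap Z W) (g : lipMap Y Z) (f : lipMap X Y) :
  lip_comp h (lip_comp g f) = lip_comp (lip_comp h g) f.
Proof. exact: lip_eq. Qed.

Definition shsec_res S T (h : lipMap S T) (a : shsec T) : shsec S.
Proof.
exists (fun V g s => rep a (lip_comp h g) s).
- by move=> V W g k s; rewrite lip_compA; exact: rep_res.
- move=> V g s I W f cf asf; apply: (rep_local cf) => i.
  by rewrite -lip_compA.
- by move=> V g s s'; exact: rep_loc_eq.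
- have [I [U [f [s [cf sf]]]]] := rep_cover a.
  exists I, (fun i => tb_fprod (f i) h), (fun i => tb_fpr2 (f i) h),
    (fun i => res (tb_fpr1 (f i) h) (s i)); split.
    exact: lsm_covering_pullback.
  move=> i; rewrite (_ : lip_comp h _ = lip_comp (f i) (tb_fpr1 (f i) h)).
    exact: rep_res.
  by apply: lip_eq => p /=; rewrite -fpE.
Defined.

Definition sheafify : presheaf R.
Proof.
exists shsec shsec_res.
- move=> T a; apply: shsec_eq => V g s /=.
  by rewrite (_ : lip_comp _ g = g) //; exact: lip_eq.
- by move=> S T V f g a; apply: shsec_eq => W h s /=; rewrite lip_compA.
Defined.

Definition to_shsec T (a : F T) : shsec T.
Proof.
exists (fun V g s => loc_eq s (res g a)).
- by move=> V W g h s sa; rewrite res_comp; exact: loc_eq_res.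
- move=> V g s I W f cf H; apply: (loc_eq_local cf) => i.
  by rewrite -res_comp.
- move=> V g s s' sa s'a; apply: loc_eq_trans sa _; exact: loc_eq_sym.
- exists unit, (fun=> T), (fun=> lip_id T), (fun=> a); split.
    exact: lsm_covering_id.
  by rewrite res_id => _; exact: loc_eq_refl.
Defined.

Definition sheafify_unit : pshMap F sheafify.
Proof.
exists to_shsec => S T f a; apply: shsec_eq => V g s /=.
by rewrite res_comp.
Defined.

Lemma sheafify_sheaf : is_sheaf sheafify.
Proof.
move=> T I U f cf s sE.
have {}sE i j V (h : lipMap V (U i)) (k : lipMap V (U j)) (a : F V) :
    (forall v, f i (h v) = f j (k v)) -> rep (s i) h a -> rep (s j) k a.
  move=> hk; have := congr1 (fun t => rep t (tb_fpair hk) a) (sE i j).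
  have -> : rep (res (tb_fpr1 (f i) (f j)) (s i)) (tb_fpair hk) a =
            rep (s i) h a.
    by rewrite /=; congr rep; exact: lip_eq.
  have -> : rep (res (tb_fpr2 (f i) (f j)) (s j)) (tb_fpair hk) a =
            rep (s j) k a.
    by rewrite /=; congr rep; exact: lip_eq.
  by move=> ->.
pose r V (g : lipMap V T) (a : F V) := forall i W (h : lipMap W V)
  (k : lipMap W (U i)), (forall w, g (h w) = f i (k w)) ->
  rep (s i) k (res h a).
have rP V (g : lipMap V T) (a : F V) i :
    r V g a -> rep (s i) (tb_fpr1 (f i) g) (res (tb_fpr2 (f i) g) a).
  by apply => w /=; rewrite -fpE.
have rf i V (g : lipMap V (U i)) (a : F V) :
    r V (lip_comp (f i) g) a <-> rep (s i) g a.
  split=> [/(_ i V (lip_id V) g)|ga j W h k hk].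
    by rewrite res_id; apply.
  by apply: (sE i j W (lip_comp g h) k) => //; exact: rep_res.
have r1 V W (g : lipMap V T) (h : lipMap W V) (a : F V) :
    r V g a -> r W (lip_comp g h) (res h a).
  by move=> ga i W' h' k' hk; rewrite -res_comp; exact: ga.
have r2 V (g : lipMap V T) (a : F V) (J : Type) (W : J -> tbMet R)
    (p : forall j, lipMap (W j) V) : lsm_covering p ->
    (forall j, r _ (lip_comp g (p j)) (res (p j) a)) -> r V g a.
  move=> cp H i W' h k hk.
  apply: (rep_local (lsm_covering_pullback h cp)) => j.
  rewrite fprod_res; apply: H => w /=.
  by rewrite -hk fpE.
have r3 V (g : lipMap V T) (a a' : F V) : r V g a -> r V g a' -> loc_eq a a'.
  move=> ga ga'; apply: (loc_eq_local (lsm_covering_pullback g cf)) => i.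
  by apply: rep_loc_eq (rP _ _ _ i ga) (rP _ _ _ i ga').
have r4 : exists (J : Type) (W : J -> tbMet R) (p : forall j, lipMap (W j) T)
    (a : forall j, F (W j)), lsm_covering p /\ forall j, r _ (p j) (a j).
  have H i := rep_cover (s i).
  pose J i := projT1 (cid (H i)); have JP i := projT2 (cid (H i)).
  pose W i := projT1 (cid (JP i)); have WP i := projT2 (cid (JP i)).
  pose p i := projT1 (cid (WP i)); have pP i := projT2 (cid (WP i)).
  pose a i := projT1 (cid (pP i)); have aP i := projT2 (cid (pP i)).
  exists {i : I & J i}, (fun k => W (tag k) (tagged k)),
    (fun k => lip_comp (f (tag k)) (p (tag k) (tagged k))),
    (fun k => a (tag k) (tagged k)); split.
    by apply: lsm_covering_comp => // i; case: (aP i).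
  by move=> [i j] /=; apply/rf; case: (aP i) => _; exact.
exists (@ShSec T r r1 r2 r3 r4); split=> [i|t tE].
  by apply: shsec_eq => V g a /=; exact: rf.
apply: shsec_eq => V g a /=; split=> [ga|ga].
  apply: (rep_local (lsm_covering_pullback g cf)) => i.
  rewrite (_ : lip_comp g _ = lip_comp (f i) (tb_fpr1 (f i) g)); last first.
    by apply: lip_eq => p /=; rewrite -fpE.
  by have := rP _ _ _ i ga; rewrite -tE.
move=> i W h k hk; rewrite -tE /=.
rewrite (_ : lip_comp (f i) k = lip_comp g h); first exact: rep_res.
by apply: lip_eq => w /=; rewrite hk.
Qed.

Theorem sheafify_universal (G : presheaf R) (p : pshMap F G) : is_sheaf G ->
  exists q : pshMap sheafify G,
    (forall T (a : F T), q T (sheafify_unit T a) = p T a) /\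
    forall q' : pshMap sheafify G,
      (forall T (a : F T), q' T (sheafify_unit T a) = p T a) ->
      forall T a, q' T a = q T a.
Proof.
move=> sG.
have sep V (a b : F V) : loc_eq a b -> p V a = p V b.
  move=> [I [W [f [cf ab]]]].
  have [|t [_ tU]] := sG V I W f cf (fun i => res (f i) (p V a)).
    by move=> i j; rewrite fprod_res.
  rewrite -(tU (p V a)) // -(tU (p V b)) // => i.
  by rewrite -!psh_nat ab.
have glue T (a : shsec T) : exists! t : G T,
    forall V (g : lipMap V T) s, rep a g s -> res g t = p V s.
  have [I [U [f [s [cf sf]]]]] := rep_cover a.
  have [|t [tE tU]] := sG T I U f cf (fun i => p _ (s i)).
    move=> i j; rewrite -!psh_nat; apply: sep.
    apply: (@rep_loc_eq _ a _ (lip_comp (f i) (tb_fpr1 (f i) (f j)))).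
      exact: rep_res.
    rewrite (_ : lip_comp _ _ = lip_comp (f j) (tb_fpr2 (f i) (f j))).
      exact: rep_res.
    by apply: lip_eq => w /=; rewrite fpE.
  exists t; split=> [V g b gb|t' t'E]; last by apply: tU => i; exact: t'E.
  have [|t' [_ t'U]] := sG V _ _ _ (lsm_covering_pullback g cf)
      (fun i => res (tb_fpr2 (f i) g) (res g t)).
    by move=> i j; exact/esym/fprod_res.
  rewrite -(t'U (res g t)) // -(t'U (p V b)) // => i.
  rewrite fprod_res tE -!psh_nat; apply: sep.
  apply: (@rep_loc_eq _ a _ (lip_comp (f i) (tb_fpr1 (f i) g))).
    rewrite (_ : lip_comp _ _ = lip_comp g (tb_fpr2 (f i) g)).
      exact: rep_res.
    by apply: lip_eq => w /=; rewrite fpE.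
  exact: rep_res.
pose q T (a : shsec T) := projT1 (cid (glue T a)).
have [qE qU] : (forall T a V (g : lipMap V T) s,
      rep a g s -> res g (q T a) = p V s) /\
    forall T (a : shsec T) t, (forall V (g : lipMap V T) s,
      rep a g s -> res g t = p V s) -> q T a = t.
  by split=> T a; rewrite /q; case: cid => t [].
have qN S T (f : lipMap S T) (a : sheafify T) : q S (res f a) = res f (q T a).
  by apply: qU => V g s /= fgs; rewrite -res_comp; exact: qE.
exists (@PshMap R sheafify G q qN); split=> [T a|q' q'E T a] /=.
  by apply: qU => V g s /= /sep ->; rewrite psh_nat.
symmetry; apply: qU => V g s gs; rewrite -psh_nat -q'E; congr (q' V _).
apply: shsec_eq => W h b /=; split=> [ghb|hb].
  by apply: (rep_loc_eq ghb); exact: rep_res.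
have [I [U [f [cf bs]]]] := hb.
apply: (rep_local cf) => i; rewrite bs -res_comp -lip_compA.
exact: rep_res.
Qed.

End Sheafification.

Section LeftKanExtension.
Context {R : realType} (F : presheaf R).
Local Notation pt := (point_tbMet R).
Local Open Scope ereal_scope.

Definition pt_of (T : tbMet R) (t : T) : lipMap pt T := lip_const pt t.

Definition compatible_epdist (d : F pt -> F pt -> \bar R) :=
  is_epdist d /\ forall (T : tbMet R) (s : F T) (t t' : T),
    d (res (pt_of t) s) (res (pt_of t') s) <= (mdist t t')%:E.

Definition mu_dist (a b : F pt) : \bar R :=
  ereal_sup [set r | exists2 d, compatible_epdist d & r = d a b].

Lemma mu_dist_ub d a b : compatible_epdist d -> d a b <= mu_dist a b.
Proof. by move=> dC; apply: ereal_sup_ubound; exists d. Qed.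

Lemma mu_dist_lub a b r :
  (forall d, compatible_epdist d -> d a b <= r) -> mu_dist a b <= r.
Proof. by move=> H; apply: ge_ereal_sup => _ [d dC ->]; exact: H. Qed.

Lemma compatible_epdist0 : compatible_epdist (fun _ _ => 0).
Proof. by split=> [|T s t t']; [split=> *; rewrite ?adde0|rewrite lee_fin mdist_ge0]. Qed.

Lemma mu_dist_compatible : compatible_epdist mu_dist.
Proof.
have ge0 x y : 0 <= mu_dist x y := mu_dist_ub x y compatible_epdist0.
split; last by move=> T s t t'; apply: mu_dist_lub => d [_]; exact.
split=> //.
- move=> x; apply/eqP; rewrite eq_le ge0 andbT.
  by apply: mu_dist_lub => d [[_ dxx _ _] _]; rewrite dxx.
- suff le x y : mu_dist x y <= mu_dist y x by move=> x y; apply/eqP; rewrite eq_le !le.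
  apply: mu_dist_lub => d dC; have [[_ _ dsym _] _] := dC.
  by rewrite dsym; exact: mu_dist_ub.
- move=> x y z; apply: mu_dist_lub => d dC; have [[_ _ _ dtri] _] := dC.
  by apply: (le_trans (dtri x y z)); apply: leeD; exact: mu_dist_ub.
Qed.

(* The left Kan extension is the colimit of the spaces [T] over the category of
   elements [(T, s \in F T)].  Its underlying set is [F pt], because the
   forgetful functor of extended pseudometric spaces is represented by the
   point and preserves colimits; its distance is the largest one making all
   the maps [t |-> t^* s] 1-Lipschitz. *)
Definition mu : epMet R :=
  EpMet (let: conj d _ := mu_dist_compatible in d).

Lemma mu_unit_subproof (T : tbMet R) (s : F T) (t t' : ep_of_met T) :
  @edist R mu (res (pt_of t) s) (res (pt_of t') s) <= edist t t'.
Proof. by case: mu_dist_compatible => _; exact. Qed.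

Definition mu_unit : pshMap F (hom_psh mu).
Proof.
exists (fun (T : tbMet R) s => @EpMap R (ep_of_met T) mu (fun t => res (pt_of t) s)
  (mu_unit_subproof s)) => S T f a; apply: epMap_eq => x /=.
by rewrite -res_comp; congr (res _ a); exact: lip_eq.
Defined.

Theorem mu_universal (X : epMet R) (p : pshMap F (hom_psh X)) :
  exists! q : epMap mu X, forall T (s : F T), p T s = ep_comp q (mu_unit T s).
Proof.
pose q (a : mu) : X := p pt a tt.
have pE T (s : F T) t : p T s t = q (res (pt_of t) s).
  by rewrite /q psh_nat.
have qP a b : edist (q a) (q b) <= edist a b.
  apply: (@mu_dist_ub (fun a b => edist (q a) (q b))).
  have [? ? ? ?] := @edistP R X; split=> // T s t t'.
  by rewrite -!pE; exact: epP (p T s) t t'.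
exists (EpMap qP); split=> [T s|q' q'E].
  by apply: epMap_eq => t; rewrite pE.
apply: epMap_eq => a /=; rewrite /q q'E /=; congr (q' _).
rewrite -[RHS](res_id a); congr (res _ a).
by apply: lip_eq => -[].
Qed.

End LeftKanExtension.

Section Quotient.
Context {T : Type} (r : T -> T -> Prop).

Definition quot := {A : T -> Prop | exists x, A = r x}.

Definition cls (x : T) : quot := exist _ (r x) (ex_intro _ x erefl).

Definition quot_rep (a : quot) : T := projT1 (cid (projT2 a)).

Lemma quot_eq (a b : quot) : sval a = sval b -> a = b.
Proof.
case: a b => [A pA] [B pB] /= AB; subst B; congr exist; exact: Prop_irrelevance.
Qed.

Lemma quot_repK a : cls (quot_rep a) = a.
Proof.
by apply: quot_eq; rewrite /quot_rep /=; case: cid => x /= ->.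
Qed.

Lemma cls_eq x y : r x x -> r y y -> (forall u v, r u v -> r v u) ->
  (forall u v w, r u v -> r v w -> r u w) -> cls x = cls y <-> r x y.
Proof.
move=> rx ry rs rt; split=> [[xy]|xy]; first by rewrite xy.
apply: quot_eq => /=.
apply: functional_extensionality_dep => z; apply: propext.
by split; apply: rt; [exact: rs|].
Qed.

End Quotient.

Section FiberedGroupoid.
Context {R : realType}.

(* Categories fibered in groupoids over [tbMet R]; [fmor x y] consists of the
   morphisms from [x] to [y] lying over an arbitrary map [fbase] of the base.
   The good moduli space of a stack is built from the fibered category only, so
   descent is not part of the record. *)
Record fibGrpd := FibGrpd {
  fob : tbMet R -> Type;
  fmor : forall S T, fob S -> fob T -> Type;
  fbase : forall S T (x : fob S) (y : fob T), fmor x y -> lipMap S T;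
  fid : forall T (x : fob T), fmor x x;
  fcomp : forall S T V (x : fob S) (y : fob T) (z : fob V),
    fmor y z -> fmor x y -> fmor x z;
  fbase_id : forall T (x : fob T), fbase (fid x) = lip_id T;
  fbase_comp : forall S T V (x : fob S) (y : fob T) (z : fob V)
    (n : fmor y z) (m : fmor x y),
    fbase (fcomp n m) = lip_comp (fbase n) (fbase m);
  fcomp1m : forall S T (x : fob S) (y : fob T) (m : fmor x y),
    fcomp (fid y) m = m;
  fcompm1 : forall S T (x : fob S) (y : fob T) (m : fmor x y),
    fcomp m (fid x) = m;
  fcompA : forall S T V W (x : fob S) (y : fob T) (z : fob V) (w : fob W)
    (p : fmor z w) (n : fmor y z) (m : fmor x y),
    fcomp p (fcomp n m) = fcomp (fcomp p n) m;
  flift : forall (S T : tbMet R) (f : lipMap S T) (y : fob T),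
    exists (x : fob S) (m : fmor x y), fbase m = f;
  fcart : forall (S T V : tbMet R) (x : fob S) (y : fob T) (z : fob V)
    (n : fmor x z) (m : fmor y z) (f : lipMap S T),
    fbase n = lip_comp (fbase m) f ->
    exists! k : fmor x y, fbase k = f /\ fcomp m k = n }.

Context (X : fibGrpd).
Implicit Types S T V : tbMet R.

(* Every morphism over an identity is invertible, by [fcart]. *)
Definition fiso T (x y : fob X T) := exists m : fmor x y, fbase m = lip_id T.

Lemma lip_comp1 (S T : tbMet R) (f : lipMap S T) : lip_comp (lip_id T) f = f.
Proof. exact: lip_eq. Qed.

Lemma fiso_refl T (x : fob X T) : fiso x x.
Proof. by exists (fid x); exact: fbase_id. Qed.

Lemma fiso_sym T (x y : fob X T) : fiso x y -> fiso y x.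
Proof.
move=> [m mE].
have [|k [[kE _] _]] := @fcart X _ _ _ _ _ _ (fid y) m (lip_id T).
  by rewrite fbase_id mE lip_comp1.
by exists k.
Qed.

Lemma fiso_trans T (x y z : fob X T) : fiso x y -> fiso y z -> fiso x z.
Proof.
move=> [m mE] [n nE]; exists (fcomp n m).
by rewrite fbase_comp mE nE lip_comp1.
Qed.

Definition iso_class T := quot (@fiso T).

Lemma iso_class_eq T (x y : fob X T) :
  cls (@fiso T) x = cls (@fiso T) y <-> fiso x y.
Proof.
apply: cls_eq; [exact: fiso_refl|exact: fiso_refl| |].
  exact: fiso_sym.
exact: fiso_trans.
Qed.

Definition pullback S T (f : lipMap S T) (y : fob X T) : fob X S :=
  projT1 (cid (flift f y)).

Definition iso_class_res S T (f : lipMap S T) (a : iso_class T) : iso_class S :=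
  cls (@fiso S) (pullback f (quot_rep a)).

Lemma iso_class_resE S T (f : lipMap S T) (x : fob X S) (y : fob X T)
    (m : fmor x y) :
  fbase m = f -> iso_class_res f (cls (@fiso T) y) = cls (@fiso S) x.
Proof.
move=> mf; rewrite /iso_class_res /pullback; apply/iso_class_eq.
case: cid => x' [m' m'E] /=.
have /iso_class_eq [k kE] : cls (@fiso T) (quot_rep (cls (@fiso T) y)) =
  cls (@fiso T) y := quot_repK _.
have [|l [[lE _] _]] := @fcart X _ _ _ _ _ _ (fcomp k m') m (lip_id S).
  by rewrite fbase_comp kE m'E mf lip_comp1; exact: lip_eq.
by exists l.
Qed.

Definition iso_classes : presheaf R.
Proof.
exists iso_class iso_class_res.
- move=> T a; rewrite -(quot_repK a).
  by apply: (iso_class_resE (m := fid (quot_rep a))); exact: fbase_id.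
- move=> S T V f g a; rewrite -(quot_repK a).
  have [x [m mf]] := flift f (quot_rep a); have [y [n ng]] := flift g x.
  rewrite (iso_class_resE mf) (iso_class_resE ng).
  by apply: (iso_class_resE (m := fcomp m n)); rewrite fbase_comp mf ng.
Defined.

Definition pi0 : presheaf R := sheafify iso_classes.

Definition good_moduli : epMet R := mu pi0.

Definition good_moduli_psh : pshMap iso_classes (hom_psh good_moduli) :=
  psh_comp (mu_unit pi0) (sheafify_unit iso_classes).

(* The morphism [X -> good_moduli X] on the objects over [T]. *)
Definition to_good_moduli T (x : fob X T) :
  epMap (ep_of_met T) good_moduli :=
  good_moduli_psh T (cls (@fiso T) x).

Lemma to_good_moduli_nat S T (x : fob X S) (y : fob X T) (m : fmor x y) :
  to_good_moduli x = ep_comp (to_good_moduli y) (ep_of_lip (fbase m)).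
Proof.
by rewrite /to_good_moduli -(iso_class_resE (m := m) erefl) psh_nat.
Qed.

Definition good_moduli_point (x : fob X (point_tbMet R)) : good_moduli :=
  to_good_moduli x tt.

Theorem good_moduli_universal (Y : epMet R)
    (p : forall T, fob X T -> epMap (ep_of_met T) Y) :
  (forall S T (x : fob X S) (y : fob X T) (m : fmor x y),
    p S x = ep_comp (p T y) (ep_of_lip (fbase m))) ->
  exists! q : epMap good_moduli Y,
    forall T (x : fob X T), p T x = ep_comp q (to_good_moduli x).
Proof.
move=> pN; pose p' T (a : iso_classes T) : hom_psh Y T := p T (quot_rep a).
have p'E T (x : fob X T) : p' T (cls (@fiso T) x) = p T x.
  have /iso_class_eq[m mE] := quot_repK (cls (@fiso T) x).
  by rewrite /p' (pN _ _ _ _ m) mE; exact: epMap_eq.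
have p'N S T (f : lipMap S T) (a : iso_classes T) :
    p' S (res f a) = res f (p' T a).
  rewrite -(quot_repK a); have [x [m mf]] := flift f (quot_rep a).
  have E : iso_class_res f (cls (@fiso T) (quot_rep a)) = cls (@fiso S) x :=
    iso_class_resE mf.
  by rewrite p'E /= E p'E (pN _ _ _ _ m) mf.
have [r [rE rU]] := sheafify_universal (PshMap p'N) (hom_psh_sheaf (Y := Y)).
have [q [qE qU]] := mu_universal r.
exists q; split=> [T x|q' q'E].
  by rewrite -p'E -[LHS]rE qE.
apply: qU => T s.
have N S V (f : lipMap S V) (a : pi0 V) :
    ep_comp q' (mu_unit pi0 S (res f a)) =
    res f (ep_comp q' (mu_unit pi0 V a) : hom_psh Y V).
  by rewrite psh_nat; exact: epMap_eq.
rewrite -(rU (@PshMap R pi0 (hom_psh Y) _ N)) // => V a.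
by rewrite /= -(quot_repK a) p'E q'E.
Qed.

End FiberedGroupoid.
Arguments fibGrpd : clear implicits.

Section ProperSubmetry.
Context {R : realType}.
Implicit Types X Y Z P T : metricType R.

Lemma metric_closureP X (A : set X) x :
  closure A x <-> forall e : R, 0 < e -> exists2 y, A y & mdist x y < e.
Proof.
split=> [clA e e0|H B /nbhs_ballP[e e0 eB]].
  by have [y [Ay /in_ball xy]] := clA _ (nbhsx_ballx x e e0); exists y.
by have [y Ay xy] := H e e0; exists y; split=> //; apply/eB/in_ball.
Qed.

Lemma metric_clusterP X (F : set_system X) x :
  cluster F x <->
  forall A (e : R), F A -> 0 < e -> exists2 y, A y & mdist x y < e.
Proof.
split=> [clF A e FA e0|H A B FA].
  by have [y [Ay /in_ball xy]] := clF A _ FA (nbhsx_ballx x e e0); exists y.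
move=> /nbhs_ballP[e e0 eB].
by have [y Ay xy] := H A e FA e0; exists y; split=> //; apply/eB/in_ball.
Qed.

Lemma lip_isoP X Y (f : lipMap X Y) :
  lip_iso f <-> (forall y, exists x, f x = y) /\
                forall x x', mdist (f x) (f x') = mdist x x'.
Proof.
split=> [[g [fK gK]]|[sf df]].
  split=> [y|x x']; first by exists (g y).
  apply/eqP; rewrite eq_le lipP -{1}(fK x) -{1}(fK x'); exact: lipP.
have [g gK] := choice sf.
have gP y y' : mdist (g y) (g y') <= mdist y y' by rewrite -df !gK.
exists (LipMap gP); split=> // x.
by apply: (@mdist_positivity R); rewrite -df gK mdistxx.
Qed.

Lemma hausdorff_dist_lt X (A B : set X) (r : R) :
  (hausdorff_dist A B < r%:E)%E ->
  (forall a, A a -> exists2 b, B b & mdist a b < r) /\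
  (forall b, B b -> exists2 a, A a & mdist a b < r).
Proof.
move=> /ereal_inf_lt[_ [s [_ AB BA] <-]]; rewrite lte_fin => sr.
split=> [a /AB|b /BA] [c Cc ac]; exists c => //; exact: lt_trans sr.
Qed.

Lemma hausdorff_dist_le X (A B : set X) (d : R) : 0 <= d ->
  (forall r, d < r -> (forall a, A a -> exists2 b, B b & mdist a b < r) /\
    (forall b, B b -> exists2 a, A a & mdist a b < r)) ->
  (hausdorff_dist A B <= d%:E)%E.
Proof.
move=> d0 H; apply/lee_addgt0Pr => e e0.
have de : d < d + e by rewrite ltrDl.
have [AB BA] := H _ de.
apply: ereal_inf_lbound; exists (d + e) => //; split=> //.
exact: le_lt_trans de.
Qed.

Lemma submetry_fiber X Z (f : lipMap X Z) x z (r : R) : submetry f ->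
  mdist (f x) z < r -> exists2 y, f y = z & mdist x y < r.
Proof.
move=> [_ fH] xz; have : (hausdorff_dist (f @^-1` [set f x]) (f @^-1` [set z])
    < r%:E)%E by apply: le_lt_trans (fH _ _) _; rewrite lte_fin.
by move=> /hausdorff_dist_lt[/(_ x erefl)[y fy xy] _]; exists y.
Qed.

Section Pullback.
Context P Z T (f : lipMap P Z) (g : lipMap T Z).

Lemma submetry_pullback : submetry f -> submetry (fpr2 f g).
Proof.
move=> sf; have [f_surj _] := sf; split=> [t|t0 t1].
  by have [p pt] := f_surj (g t); exists (FProd pt).
suff H u v r : mdist u v < r -> forall p : fprod f g, fp2 p = u ->
    exists2 q : fprod f g, fp2 q = v & mdist p q < r.
  apply: hausdorff_dist_le; first exact: mdist_ge0.
  move=> r tr; split=> p pt; first exact: H pt.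
  rewrite metric_sym in tr; have [q qt pq] := H _ _ _ tr p pt.
  by exists q => //; rewrite metric_sym.
move=> uv p pu; have : mdist (f (fp1 p)) (g v) < r.
  by rewrite fpE pu; apply: le_lt_trans uv; exact: lipP.
move=> /(submetry_fiber sf)[q qv pq]; exists (FProd qv) => //.
by rewrite fprod_distE gt_max pq /= pu.
Qed.

Lemma compact_fiber_pullback t :
  compact (f @^-1` [set g t]) -> compact (fpr2 f g @^-1` [set t]).
Proof.
move=> cf F PF Ft.
have FG : ProperFilter (fpr1 f g @ F) := fmap_proper_filter _ PF.
have [|p [pt clp]] := cf (fpr1 f g @ F) FG.
  have sub : fpr2 f g @^-1` [set t] `<=` fpr1 f g @^-1` (f @^-1` [set g t]).
    by move=> q qt; have {}qt : fp2 q = t := qt; rewrite /= -qt; exact: fpE.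
  exact: (filterS sub Ft).
exists (FProd pt); split=> //; apply/metric_clusterP => A e FA e0.
have [|_ [q [Aq qt] <-] pq] := (metric_clusterP _ _).1 clp
    (fpr1 f g @` (A `&` fpr2 f g @^-1` [set t])) e _ e0.
  have sub : A `&` fpr2 f g @^-1` [set t] `<=`
      fpr1 f g @^-1` (fpr1 f g @` (A `&` fpr2 f g @^-1` [set t])).
    by move=> q Aq; exists q.
  exact: (filterS sub (filterI FA Ft)).
exists q => //; rewrite fprod_distE gt_max pq /=.
by move: qt => /= ->; rewrite mdistxx.
Qed.

Lemma proper_pullback : submetry f -> proper_map f -> proper_map (fpr2 f g).
Proof.
move=> sf [_ cf]; split=> [A cA t /metric_closureP clt|t]; last first.
  exact: compact_fiber_pullback.
pose B (e : R) : set P := [set p | f p = g t /\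
  exists2 a : fprod f g, A a & mdist p (fp1 a) < e /\ mdist t (fp2 a) < e].
have BF : Filter (filter_from [set e : R | 0 < e] B).
  apply: filter_from_filter; first by exists 1 => /=.
  move=> e e' /= e0 e'0; exists (Num.min e e'); first by rewrite /= lt_min e0.
  move=> p [pt [a Aa]]; rewrite !lt_min => -[/andP[p1 p2] /andP[t1 t2]].
  by split; split=> //; exists a.
have BP : ProperFilter (filter_from [set e : R | 0 < e] B).
  apply: filter_from_proper => e /= e0.
  have [_ [a Aa <-] ta] := clt e e0.
  have : mdist (f (fp1 a)) (g t) < e.
    by rewrite fpE metric_sym; apply: le_lt_trans ta; exact: lipP.
  move=> /(submetry_fiber sf)[p pt ap]; exists p; split=> //.
  by exists a => //; rewrite metric_sym.
have [|p [pt clp]] := cf (g t) _ BP.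
  by exists 1 => //= p [].
exists (FProd pt) => //; apply: cA; apply/metric_closureP => e e0.
have e20 : 0 < e / 2 by rewrite divr_gt0.
have [|q [qt [a Aa [qa ta]]] pq] := (metric_clusterP _ _).1 clp
    (B (e / 2)) (e / 2) _ e20; first by exists (e / 2).
exists a => //; rewrite fprod_distE gt_max /=; apply/andP; split.
  by rewrite (splitr e); apply: le_lt_trans (metric_triangle _ q _) (ltrD pq qa).
by apply: (lt_trans ta); rewrite gtr_pMr // invf_lt1 ?ltr1n.
Qed.

End Pullback.
End ProperSubmetry.

Section GromovHausdorffStack.
Context {R : realType}.
Implicit Types S T V : tbMet R.

Record ghOb T := GHOb {
  gh_sp : metricType R;
  gh_pr : lipMap gh_sp T;
  gh_submetry : submetry gh_pr;
  gh_proper : proper_map gh_pr }.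

(* Squares over [gh_base] inducing an isomorphism onto the fiber product. *)
Record ghMor S T (x : ghOb S) (y : ghOb T) := GHMor {
  gh_base : lipMap S T;
  gh_top : lipMap (gh_sp x) (gh_sp y);
  gh_square : forall p, gh_pr y (gh_top p) = gh_base (gh_pr x p);
  gh_cart : lip_iso (fpair gh_square) }.

Lemma ghMor_eq S T (x : ghOb S) (y : ghOb T) (m n : ghMor x y) :
  gh_base m = gh_base n -> gh_top m = gh_top n -> m = n.
Proof.
case: m n => [b t s c] [b' t' s' c'] /= bb' tt'; subst b' t'.
have E : s = s' by exact: Prop_irrelevance.
by subst s'; congr GHMor; exact: Prop_irrelevance.
Qed.

Lemma gh_cartP S T (x : ghOb S) (y : ghOb T) (b : lipMap S T)
    (t : lipMap (gh_sp x) (gh_sp y))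
    (sq : forall p, gh_pr y (t p) = b (gh_pr x p)) :
  lip_iso (fpair sq) <->
  (forall q s, gh_pr y q = b s -> exists p, t p = q /\ gh_pr x p = s) /\
  (forall p p', mdist p p' =
    Num.max (mdist (t p) (t p')) (mdist (gh_pr x p) (gh_pr x p'))).
Proof.
rewrite lip_isoP; split=> -[H1 H2]; split.
- by move=> q s qs; have [p pE] := H1 (FProd qs); exists p; case: pE.
- by move=> p p'; rewrite -H2.
- by move=> [q s qs]; have [p [pq ps]] := H1 q s qs; exists p; apply: fprod_eq.
- by move=> p p'; rewrite H2.
Qed.

Lemma gh_id_subproof T (x : ghOb T) :
  lip_iso (@fpair R _ _ _ (gh_pr x) (lip_id T) _ (lip_id (gh_sp x)) (gh_pr x)
    (fun=> erefl)).
Proof.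
apply/(@gh_cartP _ _ x x (lip_id T) (lip_id (gh_sp x))); split=> [q s qs|p p'].
  by exists q.
by apply/esym/max_idPl; exact: lipP.
Qed.

Definition gh_id T (x : ghOb T) : ghMor x x :=
  @GHMor T T x x (lip_id T) (lip_id _) (fun=> erefl) (gh_id_subproof x).

Section Comp.
Context S T V (x : ghOb S) (y : ghOb T) (z : ghOb V).
Context (n : ghMor y z) (m : ghMor x y).

Lemma gh_comp_square p :
  gh_pr z (lip_comp (gh_top n) (gh_top m) p) =
  lip_comp (gh_base n) (gh_base m) (gh_pr x p).
Proof. by rewrite /= !gh_square. Qed.

Lemma gh_comp_cart : lip_iso (fpair gh_comp_square).
Proof.
have [m1 m2] := (gh_cartP _).1 (gh_cart m).
have [n1 n2] := (gh_cartP _).1 (gh_cart n).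
apply/gh_cartP; split=> [r s rs|p p'].
  have [q [qr qs]] := n1 r (gh_base m s) rs.
  by have [p [pq ps]] := m1 q s qs; exists p; rewrite /= pq.
rewrite m2 n2 !gh_square -maxA /=; congr Num.max.
by apply/max_idPr; exact: lipP.
Qed.

Definition gh_comp : ghMor x z := GHMor gh_comp_cart.
End Comp.

Lemma gh_lift S T (f : lipMap S T) (y : ghOb T) :
  exists (x : ghOb S) (m : ghMor x y), gh_base m = f.
Proof.
pose x : ghOb S := GHOb (submetry_pullback f (gh_submetry y))
  (proper_pullback f (gh_submetry y) (gh_proper y)).
have sq (p : gh_sp x) : gh_pr y (fpr1 (gh_pr y) f p) = f (gh_pr x p) := fpE p.
have c : lip_iso (fpair sq).
  by apply/gh_cartP; split=> // q s qs; exists (FProd qs).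
by exists x, (GHMor c).
Qed.

Lemma gh_cartesian S T V (x : ghOb S) (y : ghOb T) (z : ghOb V)
    (n : ghMor x z) (m : ghMor y z) (f : lipMap S T) :
  gh_base n = lip_comp (gh_base m) f ->
  exists! k : ghMor x y, gh_base k = f /\ gh_comp m k = n.
Proof.
move=> nE; have [m1 m2] := (gh_cartP _).1 (gh_cart m).
have [n1 n2] := (gh_cartP _).1 (gh_cart n).
have /choice[k kP] p : exists q, gh_top m q = gh_top n p /\
    gh_pr y q = f (gh_pr x p).
  by apply: m1; rewrite gh_square nE.
have m_inj q q' : gh_top m q = gh_top m q' -> gh_pr y q = gh_pr y q' -> q = q'.
  by move=> e1 e2; apply: (@mdist_positivity R); rewrite m2 e1 e2 !mdistxx maxxx.
have kL p p' : mdist (k p) (k p') <= mdist p p'.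
  rewrite m2; have [-> ->] := kP p; have [-> ->] := kP p'.
  rewrite n2 ge_max !le_max lexx /=; apply/orP; right; exact: lipP.
have sq p : gh_pr y (LipMap kL p) = f (gh_pr x p) by case: (kP p).
have c : lip_iso (fpair sq).
  apply/gh_cartP; split=> [q s qs|p p'].
    have [|p [pq ps]] := n1 (gh_top m q) s; first by rewrite gh_square qs nE.
    exists p; split=> //; apply: m_inj => /=; have [kp1 kp2] := kP p.
      by rewrite kp1.
    by rewrite kp2 ps.
  rewrite m2 n2 /=; have [-> ->] := kP p; have [-> ->] := kP p'.
  by rewrite -maxA; congr Num.max; apply/esym/max_idPr; exact: lipP.
exists (GHMor c); split=> [|k' [k'f k'n]].
  split=> //; apply: ghMor_eq; first by rewrite nE.
  by apply: lip_eq => p /=; case: (kP p).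
apply: ghMor_eq; first by rewrite k'f.
apply: lip_eq => p /=; apply: m_inj.
  by case: (kP p) => -> _; rewrite -k'n.
by case: (kP p) => _ ->; rewrite gh_square k'f.
Qed.

Definition GH : fibGrpd R.
Proof.
refine (@FibGrpd R ghOb ghMor (@gh_base) gh_id gh_comp
  (fun _ _ => erefl) (fun _ _ _ _ _ _ _ _ => erefl) _ _ _
  gh_lift gh_cartesian).
- by move=> S T x y m; apply: ghMor_eq; exact: lip_eq.
- by move=> S T x y m; apply: ghMor_eq; exact: lip_eq.
- by move=> S T V W x y z w p n m; apply: ghMor_eq; exact: lip_eq.
Defined.

End GromovHausdorffStack.
Arguments GH : clear implicits.

Section GromovHausdorffSpace.
Context {R : realType}.

Record compactMet := CompactMet {
  cm_sp :> metricType R;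
  cm_nonempty : [set: cm_sp] !=set0;
  cm_compact : compact [set: cm_sp] }.

Definition isometric (C D : compactMet) :=
  exists2 f : C -> D, bijective f & forall x y, mdist (f x) (f y) = mdist x y.

Definition isometry_class := quot isometric.

Definition class_of (C : compactMet) : isometry_class := cls isometric C.

(* Gromov-Hausdorff distance: infimum of the Hausdorff distances between the
   images of [C] and [D] under isometric embeddings in a common metric space. *)
Definition gh_dist (C D : compactMet) : \bar R :=
  ereal_inf [set r | exists (Z : metricType R) (i : C -> Z) (j : D -> Z),
    [/\ forall x y, mdist (i x) (i y) = mdist x y,
        forall x y, mdist (j x) (j y) = mdist x y &
        r = hausdorff_dist (range i) (range j)]].

(* Independent of the representatives, see [class_gh_distE]. *)
Definition class_gh_dist (a b : isometry_class) : \bar R :=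
  gh_dist (quot_rep a) (quot_rep b).

Lemma isometric_refl C : isometric C C.
Proof. by exists id => //; exists id. Qed.

Lemma isometric_sym C D : isometric C D -> isometric D C.
Proof.
move=> [f [g fK gK] fd]; exists g; first by exists f.
by move=> x y; rewrite -fd !gK.
Qed.

Lemma isometric_trans C D E : isometric C D -> isometric D E -> isometric C E.
Proof.
move=> [f bf fd] [g bg gd]; exists (g \o f); first exact: bij_comp.
by move=> x y; rewrite /= gd fd.
Qed.

Lemma class_of_eq C D : class_of C = class_of D <-> isometric C D.
Proof.
apply: cls_eq; [exact: isometric_refl|exact: isometric_refl| |].
  exact: isometric_sym.
exact: isometric_trans.
Qed.

Lemma gh_dist_isometric C C' D D' :
  isometric C C' -> isometric D D' -> gh_dist C D = gh_dist C' D'.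
Proof.
suff H A A' B B' : isometric A A' -> isometric B B' ->
    (gh_dist A B <= gh_dist A' B')%E.
  move=> CC' DD'; apply/eqP; rewrite eq_le !H //; exact: isometric_sym.
move=> [f [f' fK f'K] fd] [g [g' gK g'K] gd]; apply: le_ereal_inf.
move=> _ [Z [i [j [id jd ->]]]]; exists Z, (i \o f), (j \o g); split.
- by move=> x y; rewrite /= id fd.
- by move=> x y; rewrite /= jd gd.
- congr hausdorff_dist; apply/seteqP; split=> _ [x _ <-].
  + by exists (f' x) => //=; rewrite f'K.
  + by exists (f x).
  + by exists (g' x) => //=; rewrite g'K.
  + by exists (g x).
Qed.

Lemma class_gh_distE C D : class_gh_dist (class_of C) (class_of D) = gh_dist C D.
Proof. by apply: gh_dist_isometric; apply/class_of_eq; exact: quot_repK. Qed.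

Section ToPoint.
Context (C : compactMet).
Definition to_point : lipMap C (point_tbMet R) :=
  lip_const C (tt : point_tbMet R).

Lemma to_point_submetry : submetry to_point.
Proof.
have [c _] := cm_nonempty C; split=> [[]|[] []]; first by exists c.
apply: hausdorff_dist_le => [|r]; first exact: mdist_ge0.
by rewrite mdistxx => r0; split=> x _; exists x; rewrite ?mdistxx.
Qed.

Lemma to_point_proper : proper_map to_point.
Proof.
split=> [A _ []|[]].
  have [[x Ax] _|nA] := pselect (exists x, A x); first by exists x.
  move=> clA; exfalso; apply: nA; have [_ [x Ax _] _] :=
    (metric_closureP _ _).1 clA 1 ltr01; by exists x.
rewrite (_ : _ @^-1` _ = setT); first exact: cm_compact.
by apply/seteqP; split.
Qed.

Definition gh_object : fob (GH R) (point_tbMet R) :=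
  GHOb to_point_submetry to_point_proper.

End ToPoint.

End GromovHausdorffSpace.
Arguments compactMet : clear implicits.
Arguments isometry_class : clear implicits.

(* Main.v *)
(* Two compact spaces at Gromov-Hausdorff distance less than [r] are the two
   fibers of a proper submetry onto a two-point space of diameter [r]: realize
   them in a common space [Z] and, on their disjoint union, take [max r d_Z] as
   distance between a point of one and a point of the other.  So the
   distance of the good moduli space is at most the Gromov-Hausdorff distance.
   Conversely, the fibers of a proper submetry [P -> T] lie in [P] at Hausdorff
   distance at most the distance of the base points, so that sending a point of
   [T] to its fiber is 1-Lipschitz for the Gromov-Hausdorff distance; the
   universal property then gives a 1-Lipschitz map from the good moduli space
   to the Gromov-Hausdorff space, inverse to [C |-> [C]].  That every point is
   some [[C]] holds because every covering of the point has a section. *)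
From HB Require Import structures.
Require Import Defs.
From mathcomp Require Import all_boot all_order all_algebra.
From mathcomp Require Import all_classical all_reals.
From mathcomp Require Import ereal topology.

Set Implicit Arguments.
Unset Strict Implicit.
Unset Printing Implicit Defensive.

Import Order.TTheory GRing.Theory Num.Theory.
Local Open Scope classical_set_scope.
Local Open Scope ring_scope.

(** * Metrics on disjoint unions *)

Section Gluing.
Context {R : realType}.
Implicit Types X Y Z : metricType R.

(* The cross distances of a metric on the disjoint union [X + Y]. *)
Record coupling X Y := Coupling {
  cross :> X -> Y -> R;
  cross_gt0 : forall x y, 0 < cross x y;
  cross_tril : forall x x' y, cross x y <= mdist x x' + cross x' y;
  cross_trir : forall x y y', cross x y <= cross x y' + mdist y y';
  cross_distl : forall x x' y, mdist x x' <= cross x y + cross x' y;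
  cross_distr : forall x y y', mdist y y' <= cross x y + cross x y' }.

(** The sum type takes the coupling as a parameter so that each coupling gives its own metric
    structure. *)
Definition glued X Y of coupling X Y : Type := X + Y.

Section GluedMetric.
Context X Y (k : coupling X Y).

HB.instance Definition _ := Choice.copy (glued k) (X + Y)%type.

Let dist (p q : glued k) : R :=
  match p, q with
  | inl x, inl x' => mdist x x'
  | inl x, inr y | inr y, inl x => k x y
  | inr y, inr y' => mdist y y'
  end.

Let distxx p : dist p p = 0.
Proof. by case: p => x; exact: mdistxx. Qed.

Let dist_pos p q : dist p q = 0 -> p = q.
Proof.
case: p q => [x|y] [x'|y'] /= d0.
- by congr inl; exact: (@mdist_positivity R).
- by have := cross_gt0 k x y'; rewrite d0 ltxx.
- by have := cross_gt0 k x' y; rewrite d0 ltxx.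
- by congr inr; exact: (@mdist_positivity R).
Qed.

Let dist_sym p q : dist p q = dist q p.
Proof. by case: p q => [x|y] [x'|y'] //=; rewrite metric_sym. Qed.

Let dist_tri q p r : dist p r <= dist p q + dist q r.
Proof.
case: p q r => [x|y] [x'|y'] [x''|y''] /=.
- exact: metric_triangle.
- exact: cross_tril.
- exact: cross_distl.
- by rewrite [mdist y' _]metric_sym; exact: cross_trir.
- by rewrite addrC [mdist x' _]metric_sym; exact: cross_tril.
- exact: cross_distr.
- by rewrite addrC; exact: cross_trir.
- exact: metric_triangle.
Qed.

HB.instance Definition _ :=
  @isMetric.Build R (glued k) dist distxx dist_pos dist_sym dist_tri.

Definition gluel (x : X) : glued k := inl x.
Definition gluer (y : Y) : glued k := inr y.

Lemma gluelE x x' : mdist (gluel x) (gluel x') = mdist x x'.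
Proof. by []. Qed.

Lemma gluerE y y' : mdist (gluer y) (gluer y') = mdist y y'.
Proof. by []. Qed.

Lemma glue_crossE x y : mdist (gluel x) (gluer y) = k x y.
Proof. by []. Qed.

Lemma glue_crossCE x y : mdist (gluer y) (gluel x) = k x y.
Proof. by []. Qed.

End GluedMetric.

(** The lower bound on [k] will make the projection onto two points at distance [r] 1-Lipschitz; the
    last two conditions put the two copies at Hausdorff distance at most [r]. *)
Definition tight X Y (k : coupling X Y) (r : R) :=
  [/\ 0 < r, forall x y, r <= k x y,
      forall x, exists y, k x y <= r & forall y, exists x, k x y <= r].

(** Go from [x] to [z] through the cheapest midpoint in [Y]. This is the source of the triangle
    inequality for [gh_dist]. *)
Lemma tight_comp X Y Z (h : coupling X Y) (k : coupling Y Z) (r s : R)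
    (y0 : Y) :
  tight h r -> tight k s -> exists l : coupling X Z, tight l (r + s).
Proof.
move=> [r0 hr hl hrr] [s0 ks kl kr].
pose S x z := [set h x y + k y z | y in setT].
pose l x z := inf (S x z).
(* The point [y0] matters here: the infimum of an empty set of reals is a mere default value. *)
have S0 x z : S x z !=set0 by exists (h x y0 + k y0 z), y0.
have lS x z y : l x z <= h x y + k y z.
  apply: ge_inf; last by exists y.
  by exists (r + s) => _ [y' _ <-]; exact: lerD.
have Sl x z e : (forall y, e <= h x y + k y z) -> e <= l x z.
  by move=> H; apply: lb_le_inf => // _ [y _ <-].
have lrs x z : r + s <= l x z by apply: Sl => y; exact: lerD.
have l_gt0 x z : 0 < l x z by apply: lt_le_trans (lrs x z); exact: addr_gt0.
have l_tril x x' z : l x z <= mdist x x' + l x' z.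
  rewrite -lerBlDl; apply: Sl => y; rewrite lerBlDl addrA.
  by apply: le_trans (lS x z y) _; rewrite lerD2r cross_tril.
have l_trir x z z' : l x z <= l x z' + mdist z z'.
  rewrite -lerBlDr; apply: Sl => y; rewrite lerBlDr -addrA.
  by apply: le_trans (lS x z y) _; rewrite lerD2l cross_trir.
have l_distl x x' z : mdist x x' <= l x z + l x' z.
  (* Each of the two infima gets its own midpoint, [y] for [x] and [y'] for [x']; the distance
     between the midpoints is bounded through [z]. *)
  rewrite -lerBlDr; apply: (Sl) => y; rewrite lerBlDr -lerBlDl; apply: Sl => y'.
  rewrite lerBlDl; apply: le_trans (cross_distl h x x' y) _.
  rewrite -addrA lerD2l; apply: le_trans (cross_trir h x' y y') _.
  by rewrite [leRHS]addrC -addrA lerD2l addrC cross_distl.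
have l_distr x z z' : mdist z z' <= l x z + l x z'.
  rewrite -lerBlDr; apply: (Sl) => y; rewrite lerBlDr -lerBlDl; apply: Sl => y'.
  rewrite lerBlDl; apply: le_trans (cross_distr k y z z') _.
  rewrite [h x y + _]addrC -addrA lerD2l addrA.
  apply: le_trans (cross_tril k y y' z') _.
  by rewrite lerD2r cross_distr.
exists (Coupling l_gt0 l_tril l_trir l_distl l_distr); split=> //=.
- exact: addr_gt0.
- move=> x; have [y xy] := hl x; have [z yz] := kl y; exists z.
  by apply: le_trans (lS x z y) _; exact: lerD.
- move=> z; have [y yz] := kr z; have [x xy] := hrr y; exists x.
  by apply: le_trans (lS x z y) _; exact: lerD.
Qed.

(** The images may meet in [Z]; the maximum with [r] keeps cross distances positive, and points
    closer than [r] in [Z] come to cross distance exactly [r]. *)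
Lemma tight_of_embedding X Y Z (i : X -> Z) (j : Y -> Z) (r : R) : 0 < r ->
  (forall x x', mdist (i x) (i x') = mdist x x') ->
  (forall y y', mdist (j y) (j y') = mdist y y') ->
  (forall a, range i a -> exists2 b, range j b & mdist a b < r) ->
  (forall b, range j b -> exists2 a, range i a & mdist a b < r) ->
  exists k : coupling X Y, tight k r.
Proof.
move=> r0 iE jE ij ji; pose k x y := Num.max r (mdist (i x) (j y)).
have kr x y : r <= k x y by rewrite /k le_max lexx.
have kd x y : mdist (i x) (j y) <= k x y by rewrite /k le_max lexx orbT.
have k_gt0 x y : 0 < k x y by exact: lt_le_trans (kr x y).
have k_tril x x' y : k x y <= mdist x x' + k x' y.
  rewrite {1}/k ge_max (le_trans (kr x' y)) ?lerDr ?mdist_ge0 //=.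
  by apply: le_trans (metric_triangle _ (i x') _) _; rewrite iE lerD2l.
have k_trir x y y' : k x y <= k x y' + mdist y y'.
  rewrite {1}/k ge_max (le_trans (kr x y')) ?lerDl ?mdist_ge0 //=.
  apply: le_trans (metric_triangle _ (j y') _) _.
  by rewrite jE [mdist y' y]metric_sym lerD2r.
have k_distl x x' y : mdist x x' <= k x y + k x' y.
  rewrite -iE; apply: le_trans (metric_triangle _ (j y) _) _.
  by rewrite [mdist (j y) _]metric_sym lerD.
have k_distr x y y' : mdist y y' <= k x y + k x y'.
  rewrite -jE; apply: le_trans (metric_triangle _ (i x) _) _.
  by rewrite [mdist (j y) _]metric_sym lerD.
exists (Coupling k_gt0 k_tril k_trir k_distl k_distr); split=> //= [x|y].
  have [_ [y _ <-] xy] := ij (i x) (ex_intro2 _ _ x I erefl).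
  by exists y; rewrite /k ge_max lexx ltW.
have [_ [x _ <-] xy] := ji (j y) (ex_intro2 _ _ y I erefl).
by exists x; rewrite /k ge_max lexx ltW.
Qed.

Lemma tight_hausdorff X Y (k : coupling X Y) (r : R) : tight k r ->
  (hausdorff_dist (range (gluel k)) (range (gluer k)) <= r%:E)%E.
Proof.
move=> [r0 _ kl kr]; apply: hausdorff_dist_le => [|s rs]; first exact: ltW.
split=> [_ [x _ <-]|_ [y _ <-]].
  have [y xy] := kl x; exists (gluer k y); first by exists y.
  by rewrite glue_crossE; exact: le_lt_trans rs.
have [x xy] := kr y; exists (gluel k x); first by exists x.
by rewrite glue_crossE; exact: le_lt_trans rs.
Qed.

End Gluing.

(** * The Gromov-Hausdorff distance as an extended pseudometric *)

Section GromovHausdorffDistance.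
Context {R : realType}.
Implicit Types C D E : compactMet R.
Local Open Scope ereal_scope.

Lemma gh_dist_lt C D (r : R) : gh_dist C D < r%:E ->
  exists k : coupling C D, tight k r.
Proof.
move=> /ereal_inf_lt[_ [Z [i [j [iE jE ->]]]]] ZR.
have := ZR => /hausdorff_dist_lt[ij ji].
(* A point of the non-empty [C] has a partner at distance less than [r]. *)
have r0 : (0 < r)%R.
  have [c _] := cm_nonempty C.
  have [b _ cb] := ij (i c) (ex_intro2 _ _ c I erefl).
  by apply: le_lt_trans cb; exact: mdist_ge0.
exact: tight_of_embedding iE jE ij ji.
Qed.

Lemma gh_dist_le C D (k : coupling C D) (r : R) : tight k r ->
  gh_dist C D <= r%:E.
Proof.
move=> kr; apply: le_trans (tight_hausdorff kr); apply: ereal_inf_lbound.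
by exists (glued k), (gluel k), (gluer k).
Qed.

Lemma hausdorff_dist_ge0 (X : metricType R) (A B : set X) :
  0 <= hausdorff_dist A B.
Proof. by apply/ereal_infP => _ [r [r0 _ _] <-]; rewrite lee_fin ltW. Qed.

Lemma hausdorff_dist_sym (X : metricType R) (A B : set X) :
  hausdorff_dist A B = hausdorff_dist B A.
Proof.
congr ereal_inf; apply/seteqP; split=> _ [r [r0 AB BA] <-];
  exists r => //; split=> // x => [/BA|/AB] [y Ay xy];
  by exists y; rewrite // metric_sym.
Qed.

Lemma gh_dist_ge0 C D : 0 <= gh_dist C D.
Proof.
by apply/ereal_infP => _ [Z [i [j [_ _ ->]]]]; exact: hausdorff_dist_ge0.
Qed.

Lemma gh_distxx C : gh_dist C C = 0.
Proof.
apply/eqP; rewrite eq_le gh_dist_ge0 andbT.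
have H0 : hausdorff_dist (range (@id C)) (range id) <= 0%:E.
  by apply: hausdorff_dist_le => // r r0; split=> x _;
    exists x; rewrite ?mdistxx //; exists x.
by apply: le_trans H0; apply: ereal_inf_lbound; exists C, id, id.
Qed.

Lemma gh_dist_sym C D : gh_dist C D = gh_dist D C.
Proof.
congr ereal_inf; apply/seteqP; split=> _ [Z [i [j [iE jE ->]]]];
  by exists Z, j, i; split=> //; exact: hausdorff_dist_sym.
Qed.

Lemma gh_dist_triangle C D E : gh_dist C E <= gh_dist C D + gh_dist D E.
Proof.
have := gh_dist_ge0 C D; have := gh_dist_ge0 D E.
(* If a summand is infinite the bound is trivial, so finiteness of [gh_dist] need not be known. *)
case ab: (gh_dist C D) => [a| |] //; case bc: (gh_dist D E) => [b| |] // _ _;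
  rewrite ?leey //.
apply/lee_addgt0Pr => e e0; have e20 : (0 < e / 2)%R by rewrite divr_gt0.
have [|h ha] := @gh_dist_lt C D (a + e / 2)%R.
  by rewrite ab lte_fin ltrDl.
have [|k kb] := @gh_dist_lt D E (b + e / 2)%R.
  by rewrite bc lte_fin ltrDl.
have [d _] := cm_nonempty D.
have [l lab] := tight_comp d ha kb; apply: le_trans (gh_dist_le lab) _.
by rewrite -!EFinD addrACA -splitr.
Qed.

Lemma class_gh_epdist : is_epdist (@class_gh_dist R).
Proof.
split=> *; [exact: gh_dist_ge0|exact: gh_distxx|exact: gh_dist_sym|].
exact: gh_dist_triangle.
Qed.

Definition gh_space : epMet R := EpMet class_gh_epdist.

End GromovHausdorffDistance.

(** * Fibers of a proper submetry and the map to the Gromov-Hausdorff space *)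

Section Fibers.
Context {R : realType}.
Implicit Types S T : tbMet R.
Local Notation pt := (point_tbMet R).

Lemma point_eq (u v : pt) : u = v.
Proof. by case: u; case: v. Qed.

Section Fiber.
Context T (x : ghOb T) (t : T).

(** As a fiber product with the point, the fiber is a metric space at once, and its compactness is
    an instance of base change. *)
Let F : metricType R := Defs.fprod (gh_pr x) (pt_of t).

Definition fiber_point p (pt : gh_pr x p = t) : F :=
  @Defs.FProd _ _ _ _ (gh_pr x) (pt_of t) p tt pt.

Lemma fiber_nonempty : [set: F] !=set0.
Proof.
by have [p pt] := (gh_submetry x).1 t; exists (fiber_point pt).
Qed.

Lemma fiber_compact : compact [set: F].
Proof.
have := compact_fiber_pullback (g := pt_of t) (t := tt) ((gh_proper x).2 t).
rewrite (_ : _ @^-1` _ = setT) //; apply/seteqP; split=> // p _.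
exact: point_eq.
Qed.

Definition fiber : compactMet R := CompactMet fiber_nonempty fiber_compact.

Lemma fiber_distE (p q : fiber) : mdist p q = mdist (fp1 p) (fp1 q).
Proof.
by rewrite fprod_distE point_distE; apply/max_idPl; exact: mdist_ge0.
Qed.

Lemma range_fiber : range (fun p : fiber => fp1 p) = gh_pr x @^-1` [set t].
Proof.
apply/seteqP; split=> [_ [p _ <-]|p pt] /=; first exact: fpE p.
by exists (fiber_point pt).
Qed.

End Fiber.

(** The total space itself is a common metric space for both fibers, where the submetry condition
    bounds their Hausdorff distance. *)
Lemma gh_dist_fiber T (x : ghOb T) (t u : T) :
  (gh_dist (fiber x t) (fiber x u) <= (mdist t u)%:E)%E.
Proof.
apply: le_trans ((gh_submetry x).2 t u); apply: ereal_inf_lbound.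
exists (gh_sp x), (fun p => fp1 p), (fun p => fp1 p); split.
- by move=> p q; rewrite fiber_distE.
- by move=> p q; rewrite fiber_distE.
- by rewrite !range_fiber.
Qed.

Lemma surjection_isometric (C D : compactMet R) (f : C -> D) :
  (forall y, exists x, f x = y) ->
  (forall x x', mdist (f x) (f x') = mdist x x') ->
  isometric C D.
Proof.
move=> sf df; exists f => //.
have fL x x' : mdist (f x) (f x') <= mdist x x' by rewrite df.
have /lip_isoP[g [fK gK]] : (forall y, exists x, LipMap fL x = y) /\
  forall x x', mdist (LipMap fL x) (LipMap fL x') = mdist x x' by [].
by exists g.
Qed.

(** Cartesianness makes the upstairs distance the maximum of the distance of the images and that in
    the base; the latter vanishes inside a fiber. *)
Lemma fiber_mor S T (x : ghOb S) (y : ghOb T) (m : ghMor x y) (s : S) :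
  isometric (fiber x s) (fiber y (gh_base m s)).
Proof.
have [m1 m2] := (gh_cartP _).1 (gh_cart m).
have fE (p : fiber x s) : gh_pr x (fp1 p) = s by exact: fpE p.
have gE (p : fiber x s) : gh_pr y (gh_top m (fp1 p)) = pt_of (gh_base m s) tt.
  by rewrite gh_square fE.
apply: (@surjection_isometric _ (fiber y _)
  (fun p => Defs.FProd (gE p) : fiber y _)).
  move=> q; have qE : gh_pr y (fp1 q) = gh_base m s := fpE q.
  have [p [pq ps]] := m1 _ _ qE.
  exists (fiber_point ps).
  by apply: fprod_eq => //=; exact: point_eq.
move=> p q; rewrite !fiber_distE /= m2 !fE mdistxx.
by apply/esym/max_idPl; exact: mdist_ge0.
Qed.

Lemma fiber_gh_object (C : compactMet R) (t : pt) :
  isometric (fiber (gh_object C) t) C.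
Proof.
pose f (p : fiber (gh_object C) t) : C := fp1 p.
have := @surjection_isometric (fiber (gh_object C) t) C f; apply=> [c|p q].
  have ct : gh_pr (gh_object C) c = pt_of t tt by exact: point_eq.
  by exists (Defs.FProd ct).
by rewrite fiber_distE.
Qed.

Lemma fiber_lip T (x : ghOb T) (t u : ep_of_met T) :
  (@edist R (gh_space (R := R)) (class_of (fiber x t)) (class_of (fiber x u))
   <= edist t u)%E.
Proof. by rewrite /= class_gh_distE; exact: gh_dist_fiber. Qed.

Definition fiber_class T (x : ghOb T) : epMap (ep_of_met T) gh_space :=
  @EpMap R (ep_of_met T) gh_space (fun t => class_of (fiber x t)) (fiber_lip x).

Lemma good_moduli_fiber : exists q : epMap (good_moduli (GH R)) gh_space,
  forall C : compactMet R, q (good_moduli_point (gh_object C)) = class_of C.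
Proof.
have nat S T (x : fob (GH R) S) (y : fob (GH R) T) (m : fmor x y) :
    fiber_class x = ep_comp (fiber_class y) (ep_of_lip (fbase m)).
  by apply: epMap_eq => s; apply/class_of_eq; exact: fiber_mor m s.
have [q [qE _]] := good_moduli_universal nat.
exists q => C; have := qE _ (gh_object C).
move=> /(congr1 (fun f : epMap (ep_of_met pt) _ => f tt)) /= <-.
by apply/class_of_eq; exact: fiber_gh_object.
Qed.

End Fibers.

(** * Points of the good moduli space *)

Section PointsOfGoodModuli.
Context {R : realType}.
Local Notation pt := (point_tbMet R).

Lemma lsm_covering_inhabited (I : Type) (U : I -> tbMet R)
    (f : forall i, lipMap (U i) pt) : lsm_covering f ->
  exists i, inhabited (U i).
Proof.
move=> cf; have [i [u _]] := lsm_points cf tt tt tt ltr01.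
by exists i.
Qed.

Lemma lip_point_eq (V : tbMet R) (f g : lipMap V pt) : f = g.
Proof. by apply: lip_eq => v; exact: point_eq. Qed.

(** Some member of a covering of the point has a point [u]; restricting its local section along [u]
    gives a global representative. *)
Lemma sheafify_point (F : presheaf R) (a : sheafify F pt) :
  exists s : F pt, a = sheafify_unit F pt s.
Proof.
have [I [U [f [s [/lsm_covering_inhabited[i [u]] /(_ i) fs]]]]] := rep_cover a.
exists (res (pt_of u) (s i)); apply: shsec_eq => V g b /=.
(* Any two maps to the point agree, so the restricted section represents [a] along every [h]. *)
have ua (W : tbMet R) (h : lipMap W pt) : rep a h (res h (res (pt_of u) (s i))).
  have := rep_res (lip_comp (pt_of u) h) fs.
  by rewrite res_comp (lip_point_eq (lip_comp (f i) _) h).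
split=> [ab|[J [W [h [ch hE]]]]]; first exact: rep_loc_eq ab (ua V g).
apply: (rep_local ch) => j; rewrite hE -res_comp; exact: ua.
Qed.

(** An isometry of [C] onto the fiber is a cartesian square over [t], so naturality of
    [to_good_moduli] applies. *)
Lemma to_good_moduli_fiber (T : tbMet R) (x : ghOb T) (t : T)
    (C : compactMet R) (i : C -> gh_sp x) :
  (forall c c', mdist (i c) (i c') = mdist c c') ->
  range i = gh_pr x @^-1` [set t] ->
  to_good_moduli (X := GH R) x t = good_moduli_point (gh_object C).
Proof.
move=> iE ir.
have iL c c' : mdist (i c) (i c') <= mdist c c' by rewrite iE.
have it c : gh_pr x (i c) = t.
  have : range i (i c) by exists c.
  by rewrite ir.
have sq (c : gh_sp (gh_object C)) :
    gh_pr x (LipMap iL c) = pt_of t (gh_pr (gh_object C) c) := it c.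
have c : lip_iso (fpair sq).
  apply/gh_cartP; split=> [q s qs|p p'].
    have : range i q by rewrite ir.
    by move=> [p _ pq]; exists p; split=> //; exact: point_eq.
  by rewrite point_distE max_l ?mdist_ge0 //; exact/esym/iE.
by rewrite /good_moduli_point
  (@to_good_moduli_nat _ (GH R) _ _ (gh_object C) x (GHMor c)).
Qed.

Lemma good_moduli_point_isometric (C D : compactMet R) : isometric C D ->
  good_moduli_point (gh_object C) = good_moduli_point (gh_object D).
Proof.
move=> [f [g _ gK] fd]; symmetry.
apply: (@to_good_moduli_fiber _ (gh_object D) (tt : pt) C f) => //.
by apply/seteqP; split=> // d _; exists (g d).
Qed.

Lemma good_moduli_point_surj (a : good_moduli (GH R)) :
  exists C : compactMet R, a = good_moduli_point (gh_object C).
Proof.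
have [s ->] := sheafify_point a; pose x : ghOb pt := quot_rep s.
(* Restricting along the identity, rewritten as [pt_of tt], turns the point into the value at [tt]
   of the map classifying [x]. *)
exists (fiber x tt); rewrite -(quot_repK s) -[LHS]res_id.
rewrite (lip_point_eq (lip_id pt) (pt_of (tt : pt))).
apply: (@to_good_moduli_fiber _ x tt _ (fun p : fiber x tt => fp1 p)).
  by move=> p q; rewrite fiber_distE.
exact: range_fiber.
Qed.

End PointsOfGoodModuli.

(** * The two-fiber family over a two-point space *)

Section GluedFamily.
Context {R : realType}.
Local Notation pt := (point_tbMet R).

Section TwoPoints.
Context (r : R) (r0 : 0 < r).

Definition two_point_coupling : coupling pt pt.
Proof.
by exists (fun _ _ => r) => *;
  rewrite ?point_distE ?add0r ?addr0 // addr_ge0 ?ltW.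
Defined.

Definition left_point : glued two_point_coupling := gluel _ (tt : pt).
Definition right_point : glued two_point_coupling := gluer _ (tt : pt).

Lemma two_points_tb : totally_bounded (glued two_point_coupling).
Proof.
move=> e e0; exists [:: left_point; right_point] => -[[]|[]].
  by exists left_point; rewrite ?mdistxx // !inE eqxx.
by exists right_point; rewrite ?mdistxx // !inE eqxx orbT.
Qed.

Definition two_points : tbMet R := TbMet two_points_tb.

(** Distinct points are at distance [r], so the space is discrete and every map into it is
    closed. *)
Lemma two_points_closed (A : set two_points) : closed A.
Proof.
move=> t /metric_closureP /(_ r r0)[u Au]; case: t u Au => [[]|[]] [[]|[]] //=.
- by rewrite glue_crossE /= ltxx.
- by rewrite glue_crossCE /= ltxx.
Qed.

End TwoPoints.

Lemma compact_range_isometry (C : compactMet R) (Y : metricType R)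
    (i : C -> Y) :
  (forall x x', mdist (i x) (i x') = mdist x x') -> compact (range i).
Proof.
move=> iE; apply: continuous_compact (@cm_compact _ C).
apply/continuous_subspaceT => x; apply/cvg_ballP => e e0; near=> y.
apply/in_ball; rewrite iE; apply/in_ball; near: y; exact: nbhsx_ballx.
Unshelve. all: by end_near. Qed.

Context (C D : compactMet R) (k : coupling C D) (r : R) (kr : tight k r).
Let r0 : 0 < r. Proof. by case: kr. Qed.

Let proj (p : glued k) : two_points r0 :=
  match p with inl _ => left_point r0 | inr _ => right_point r0 end.

Let proj_lip p q : mdist (proj p) (proj q) <= mdist p q.
Proof.
have [_ rk _ _] := kr.
case: p q => [x|y] [x'|y'] /=; rewrite ?mdistxx ?mdist_ge0 //; exact: rk.
Qed.

Lemma glued_fiberl :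
  range (gluel k) = LipMap proj_lip @^-1` [set left_point r0].
Proof. by apply/seteqP; split=> [_ [x _ <-]|[x|y] //= _] //; exists x. Qed.

Lemma glued_fiberr :
  range (gluer k) = LipMap proj_lip @^-1` [set right_point r0].
Proof. by apply/seteqP; split=> [_ [y _ <-]|[x|y] //= _] //; exists y. Qed.

Lemma glued_submetry : submetry (LipMap proj_lip).
Proof.
have [c _] := cm_nonempty C; have [d _] := cm_nonempty D.
have H := tight_hausdorff kr; rewrite glued_fiberl glued_fiberr in H.
split=> [[[]|[]]|t u]; [by exists (gluel _ c)|by exists (gluer _ d)|].
have [<-|] := pselect (t = u).
  rewrite mdistxx; apply: hausdorff_dist_le => // s s0.
  by split=> p pt; exists p; rewrite ?mdistxx.
case: t u => [[]|[]] [[]|[]] tu; [by []|exact: H| |by []].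
by rewrite hausdorff_dist_sym; exact: H.
Qed.

Lemma glued_proper : proper_map (LipMap proj_lip).
Proof.
split=> [A _|]; first exact: two_points_closed.
move=> [[]|[]]; [rewrite -glued_fiberl|rewrite -glued_fiberr];
  exact: compact_range_isometry.
Qed.

Definition glued_family : ghOb (two_points r0) :=
  GHOb glued_submetry glued_proper.

(** Both points are values of the 1-Lipschitz map classifying [glued_family], taken at base points
    at distance [r]. *)
Lemma good_moduli_dist_le :
  (edist (good_moduli_point (gh_object C)) (good_moduli_point (gh_object D))
   <= r%:E)%E.
Proof.
rewrite -(@to_good_moduli_fiber _ _ glued_family _ _ _ (@gluelE _ _ _ k)
  glued_fiberl).
rewrite -(@to_good_moduli_fiber _ _ glued_family _ _ _ (@gluerE _ _ _ k)
  glued_fiberr).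
exact: (epP (to_good_moduli (X := GH R) glued_family)).
Qed.

End GluedFamily.

(** * Comparison of the two spaces *)

Lemma good_moduli_distE (R : realType) (C D : compactMet R) :
  edist (good_moduli_point (gh_object C)) (good_moduli_point (gh_object D))
  = gh_dist C D.
Proof.
apply/eqP; rewrite eq_le; apply/andP; split.
  have := gh_dist_ge0 C D; case E: (gh_dist C D) => [a| |] // _;
    last exact: leey.
  (* A tight coupling is only available for values strictly above the infimum. *)
  apply/lee_addgt0Pr => e e0.
  have [|k kr] := @gh_dist_lt _ C D (a + e); first by rewrite E lte_fin ltrDl.
  exact: good_moduli_dist_le kr.
have [q qE] := @good_moduli_fiber R.
by rewrite -class_gh_distE -!qE; exact: (epP q).
Qed.

Theorem theorem5p9 (R : realType) :
  [/\ exists2 phi : isometry_class R -> good_moduli (GH R),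
        bijective phi &
        forall C : compactMet R, phi (class_of C) = good_moduli_point (gh_object C),
      forall C D : compactMet R,
        edist (good_moduli_point (gh_object C)) (good_moduli_point (gh_object D))
        = gh_dist C D &
      exists2 phi : isometry_class R -> good_moduli (GH R),
        bijective phi &
        forall a b : isometry_class R,
          edist (phi a) (phi b) = class_gh_dist a b].
Proof.
pose phi (a : isometry_class R) : good_moduli (GH R) :=
  good_moduli_point (gh_object (quot_rep a)).
have phiE C : phi (class_of C) = good_moduli_point (gh_object C).
  by apply: good_moduli_point_isometric; apply/class_of_eq; exact: quot_repK.
have phi_bij : bijective phi.
  have [q qE] := @good_moduli_fiber R.
  (* The map [q] sending a point to its fiber class inverts [phi]: on classes by its defining
     property, on points because each is the class of some [C]. *)
  exists q => [a|b]; first by rewrite /phi qE; exact: quot_repK.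
  by have [C ->] := good_moduli_point_surj b; rewrite qE phiE.
split; [by exists phi|exact: good_moduli_distE|exists phi => // a b].
exact: good_moduli_distE.
Qed.
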